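(* Let $G$ be a finite group and let $\mathscr{O}$ and $\mathscr{P}$ be $N$ operads (in $\mathbf{Set}^G$). Then: (1) the product $\mathscr{O}\times\mathscr{P}$ (in $\mathbf{Op}^G$) is an $N$ operad and $A(\mathscr{O}\times\mathscr{P}) = A(\mathscr{O})\wedge A(\mathscr{P})$; (2) the coproduct $\mathscr{O}*\mathscr{P}$ (in $\mathbf{Op}^G$) is an $N$ operad and $A(\mathscr{O}*\mathscr{P}) = A(\mathscr{O})\vee A(\mathscr{P})$; (3) if $\mathscr{O}$ and $\mathscr{P}$ are both retracts of free operads (in $\mathbf{Op}^G$), then the Boardman-Vogt tensor product $\mathscr{O}\otimes\mathscr{P}$ is an $N$ operad and $A(\mathscr{O}\otimes\mathscr{P}) = A(\mathscr{O})\vee A(\mathscr{P})$.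
   Context: $G$ is a finite group. $\mathbf{Op}^G$ is the category of symmetric operads in the category $\mathbf{Set}^G$ of left $G$-sets (with cartesian product): each $\mathscr{O}(n)$, $n\ge 0$, is a set with commuting left $G$-action and right $\Sigma_n$-action, the identity $\mathrm{id}\in\mathscr{O}(1)$ is $G$-fixed, and the composition maps $\gamma$ are $G$-equivariant. We regard $\mathscr{O}(n)$ as a left $G\times\Sigma_n$-set via $(g,\sigma)\cdot x = gx\sigma^{-1}$. $\mathbf{Sym}^G$ is the category of symmetric sequences in $\mathbf{Set}^G$ (sequences $S(n)$, $n\geq 0$, with commuting left $G$- and right $\Sigma_n$-actions), and $F:\mathbf{Sym}^G\to\mathbf{Op}^G$ is the left adjoint of the forgetful functor; a free operad is one of the form $F(S)$. An $N$ operad is an operad $\mathscr{O}\in\mathbf{Op}^G$ such that, for every $n\ge 0$, the $\Sigma_n$-action on $\mathscr{O}(n)$ is free and $\mathscr{O}(n)^G\neq\varnothing$. Given a subgroup $H\subset G$ and a finite $H$-set $T$ with $|T|=n$, let $\Gamma(T)=\{(h,\sigma(h)) \mid h\in H\}\subset G\times\Sigma_n$, where $\sigma:H\to\Sigma_n$ is a chosen permutation representation of $T$ (different choices give conjugate subgroups). $T$ is admissible for $\mathscr{O}$ if $\mathscr{O}(|T|)^{\Gamma(T)}\ne\varnothing$. $A(\mathscr{O})$ is the class of all admissible sets of $\mathscr{O}$, graded over the subgroups $H\subset G$; for an $N$ operad it is a $G$-indexing system. A $G$-indexing system is a class $\mathcal{I}$ graded over the subgroups of $G$, whose $H$-component $\mathcal{I}(H)$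 is a class of finite $H$-sets, which contains all finite trivial actions and is closed under isomorphism, conjugation, restriction to subgroups, subobjects, finite coproducts, and self-induction (if $T\in\mathcal{I}(K)$ and $H/K\in\mathcal{I}(H)$ then $H\times_K T\in\mathcal{I}(H)$). Indexing systems form a lattice under inclusion; the meet $\mathcal{I}\wedge\mathcal{J}$ is the intersection and the join $\mathcal{I}\vee\mathcal{J}$ is the least indexing system containing $\mathcal{I}\cup\mathcal{J}$. The tensor product $\mathscr{O}\otimes\mathscr{P}$ is the quotient operad of the coproduct $i:\mathscr{O}\to\mathscr{O}*\mathscr{P}\leftarrow\mathscr{P}:j$ in $\mathbf{Op}^G$ by the (operadic) congruence relation generated by the interchange relations $\gamma(i(h);j(f),\dots,j(f))\sim\gamma(j(f);i(h),\dots,i(h))\cdot\sigma$ for all $m,n\ge 0$, $h\in\mathscr{O}(m)$, $f\in\mathscr{P}(n)$, where $\sigma\in\Sigma_{mn}$ is the permutation making this read, in variables, $h(f(x_{11},\dots,x_{1n}),\dots,f(x_{m1},\dots,x_{mn}))\sim f(h(x_{11},\dots,x_{m1}),\dots,h(x_{1n},\dots,x_{mn}))$. Nullary $h$ or $f$ are allowed. *)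

(* Defs.v *)
From HB Require Import structures.
From mathcomp Require Import all_boot all_order all_fingroup.
From mathcomp Require Import boolp.

Set Implicit Arguments.
Unset Strict Implicit.
Unset Printing Implicit Defensive.

Import GroupScope.

Definition arcast (S : nat -> Type) m n (e : m = n) (x : S m) : S n :=
  eq_rect m S x n e.

(* The inputs of gamma(x; y_0, ..., y_{n-1}), with y_i of arity k i, are the
   elements of 'I_(\sum_i k i); they are identified with the pairs (i, j),
   j : 'I_(k i), in lexicographic order, by [tagnat.Rank], with inverse
   [tagnat.sig1], [tagnat.sig2]. *)
Notation rk := tagnat.Rank.
Notation rk1 := tagnat.sig1.
Notation rk2 := tagnat.sig2.

Lemma rkK n (k : 'I_n -> nat) (T : Type) (f : forall i, 'I_(k i) -> T) i j :
  f (rk1 (rk i j)) (rk2 (rk i j)) = f i j.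
Proof. by rewrite /tagnat.sig1 /tagnat.sig2 /tagnat.Rank tagnat.rankK. Qed.

Lemma sum_perm n (k : 'I_n -> nat) (s : 'S_n) :
  (\sum_(i < n) k i = \sum_(i < n) k (s i))%N.
Proof. by rewrite (reindex_inj (@perm_inj _ s)). Qed.

Lemma sum_ones n : (\sum_(i < n) 1 = n)%N.
Proof. by rewrite sum1_card card_ord. Qed.

Lemma sum_one m : (\sum_(i < 1) m = m)%N.
Proof. by rewrite big_ord1. Qed.

Lemma sum_sum n (k : 'I_n -> nat) (l : forall i, 'I_(k i) -> nat) :
  (\sum_(a < \sum_(i < n) k i) l (rk1 a) (rk2 a)
   = \sum_(i < n) \sum_(j < k i) l i j)%N.
Proof.
rewrite sig_big_dep /= (reindex _ (@tagnat.sig_bij_on n k)) /=.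
by apply: eq_bigr => a _.
Qed.

Lemma sum_swap m n : (\sum_(b < n) m = \sum_(a < m) n)%N.
Proof. by rewrite !sum_nat_const !card_ord mulnC. Qed.

(* The permutation carrying the i-th block to the (s i)-th block, where the
   blocks of the source have lengths k (s 0), k (s 1), ... *)
Definition block_fun n (k : 'I_n -> nat) (s : 'S_n)
    (a : 'I_(\sum_(i < n) k (s i))) : 'I_(\sum_(i < n) k (s i)) :=
  cast_ord (sum_perm k s) (rk (s (rk1 a)) (rk2 a)).

Lemma block_fun_inj n (k : 'I_n -> nat) (s : 'S_n) : injective (@block_fun n k s).
Proof.
move=> a b /cast_ord_inj /eqP; rewrite -val_eqE tagnat.eq_Rank.
rewrite (inj_eq perm_inj) -tagnat.eq_Rank !tagnat.sig2K.
by move/eqP/val_inj.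
Qed.

Definition block_perm n (k : 'I_n -> nat) (s : 'S_n) : 'S_(\sum_(i < n) k (s i)) :=
  perm (@block_fun_inj n k s).

Definition dsum_fun n (k : 'I_n -> nat) (t : forall i, 'S_(k i))
    (a : 'I_(\sum_(i < n) k i)) : 'I_(\sum_(i < n) k i) :=
  rk (rk1 a) (t (rk1 a) (rk2 a)).

Lemma dsum_fun_inj n (k : 'I_n -> nat) (t : forall i, 'S_(k i)) :
  injective (dsum_fun t).
Proof.
apply: (@can_inj _ _ _ (fun a => rk (rk1 a) ((t (rk1 a))^-1 (rk2 a)))) => a.
rewrite /dsum_fun (rkK (fun i j => rk i ((t i)^-1 j))) permK.
exact: tagnat.sig2K.
Qed.

Definition dsum_perm n (k : 'I_n -> nat) (t : forall i, 'S_(k i)) :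
  'S_(\sum_(i < n) k i) := perm (@dsum_fun_inj n k t).

(* (a, b) |-> (b, a), from m blocks of length n to n blocks of length m. *)
Definition swap_fun m n (c : 'I_(\sum_(a < m) n)) : 'I_(\sum_(a < m) n) :=
  cast_ord (sum_swap m n) (@rk n (fun=> m) (rk2 c) (rk1 c)).

Lemma swap_fun_inj m n : injective (@swap_fun m n).
Proof.
move=> a b /cast_ord_inj /eqP; rewrite -val_eqE tagnat.eq_Rank.
rewrite andbC val_eqE -[rk2 a == _]val_eqE -tagnat.eq_Rank !tagnat.sig2K.
by move/eqP/val_inj.
Qed.

Definition swap_perm m n : 'S_(\sum_(a < m) n) := perm (@swap_fun_inj m n).

Section Operads.

Variable G : finGroupType.

(* In MathComp the product t * s of permutations is the composite s \o t, so
   [sactM] is the right action law x(st) = (xs)t for the usual product of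
   Sigma_n. *)
Record symseq := Symseq {
  sym_car :> nat -> Type;
  gact : forall n, G -> sym_car n -> sym_car n;
  sact : forall n, sym_car n -> 'S_n -> sym_car n;
  gact1 : forall n (x : sym_car n), gact 1 x = x;
  gactM : forall n g h (x : sym_car n), gact (g * h) x = gact g (gact h x);
  sact1 : forall n (x : sym_car n), sact x 1 = x;
  sactM : forall n (x : sym_car n) s t, sact x (t * s) = sact (sact x s) t;
  gsactC : forall n g (x : sym_car n) s, gact g (sact x s) = sact (gact g x) s }.

Record operad := Operad {
  op_sym :> symseq;
  opid : op_sym 1%N;
  gam : forall n (k : 'I_n -> nat),
    op_sym n -> (forall i, op_sym (k i)) -> op_sym (\sum_(i < n) k i)%N;
  gact_id : forall g, gact g opid = opid;
  gact_gam : forall n (k : 'I_n -> nat) g (x : op_sym n)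
      (y : forall i, op_sym (k i)),
    gact g (gam x y) = gam (gact g x) (fun i => gact g (y i));
  gam_idl : forall m (y : op_sym m),
    arcast (sum_one m) (gam opid (fun=> y)) = y;
  gam_idr : forall n (x : op_sym n),
    arcast (sum_ones n) (gam x (fun=> opid)) = x;
  gamA : forall n (k : 'I_n -> nat) (l : forall i, 'I_(k i) -> nat)
      (x : op_sym n) (y : forall i, op_sym (k i))
      (z : forall i j, op_sym (l i j)),
    arcast (sum_sum l) (gam (gam x y) (fun a => z (rk1 a) (rk2 a)))
    = gam x (fun i => gam (y i) (z i));
  gam_sactl : forall n (k : 'I_n -> nat) (x : op_sym n) (s : 'S_n)
      (y : forall i, op_sym (k i)),
    gam (sact x s) (fun i => y (s i))
    = sact (arcast (sum_perm k s) (gam x y)) (block_perm k s);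
  gam_sactr : forall n (k : 'I_n -> nat) (x : op_sym n)
      (y : forall i, op_sym (k i)) (t : forall i, 'S_(k i)),
    gam x (fun i => sact (y i) (t i)) = sact (gam x y) (dsum_perm t) }.

Definition is_symhom (S T : symseq) (f : forall n, S n -> T n) : Prop :=
  (forall n g (x : S n), f n (gact g x) = gact g (f n x)) /\
  (forall n (x : S n) s, f n (sact x s) = sact (f n x) s).

Definition is_ophom (O P : operad) (f : forall n, O n -> P n) : Prop :=
  [/\ is_symhom f, f 1%N (opid O) = opid P &
      forall n (k : 'I_n -> nat) (x : O n) (y : forall i, O (k i)),
        f _ (gam x y) = gam (f n x) (fun i => f (k i) (y i))].

Record symhom (S T : symseq) := Symhom {
  symhom_fun :> forall n, S n -> T n;
  symhomP : is_symhom symhom_fun }.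

Record ophom (O P : operad) := Ophom {
  ophom_fun :> forall n, O n -> P n;
  ophomP : is_ophom ophom_fun }.

Definition is_product (O P X : operad) (p : ophom X O) (q : ophom X P) : Prop :=
  forall (Z : operad) (f : ophom Z O) (g : ophom Z P),
    exists h : ophom Z X,
      (forall n z, p n (h n z) = f n z /\ q n (h n z) = g n z) /\
      (forall h' : ophom Z X,
         (forall n z, p n (h' n z) = f n z /\ q n (h' n z) = g n z) ->
         forall n z, h' n z = h n z).

Definition is_coproduct (O P C : operad) (i : ophom O C) (j : ophom P C) : Prop :=
  forall (Z : operad) (f : ophom O Z) (g : ophom P Z),
    exists h : ophom C Z,
      ((forall n x, h n (i n x) = f n x) /\ (forall n y, h n (j n y) = g n y)) /\
      (forall h' : ophom C Z,
         (forall n x, h' n (i n x) = f n x) /\ (forall n y, h' n (j n y) = g n y) ->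
         forall n z, h' n z = h n z).

Definition is_free_on (S : symseq) (F : operad) (eta : symhom S F) : Prop :=
  forall (Z : operad) (f : symhom S Z),
    exists h : ophom F Z,
      (forall n x, h n (eta n x) = f n x) /\
      (forall h' : ophom F Z,
         (forall n x, h' n (eta n x) = f n x) -> forall n z, h' n z = h n z).

Definition is_free (F : operad) : Prop :=
  exists (S : symseq) (eta : symhom S F), is_free_on eta.

Definition is_retract_of_free (O : operad) : Prop :=
  exists (F : operad) (s : ophom O F) (r : ophom F O),
    is_free F /\ forall n x, r n (s n x) = x.

Record is_congruence (O : operad) (R : forall n, O n -> O n -> Prop) : Prop :=
  IsCongruence {
    cong_refl : forall n (x : O n), R n x x;
    cong_sym : forall n (x y : O n), R n x y -> R n y x;
    cong_trans : forall n (x y z : O n), R n x y -> R n y z -> R n x z;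
    cong_gact : forall n g (x y : O n), R n x y -> R n (gact g x) (gact g y);
    cong_sact : forall n (x y : O n) s, R n x y -> R n (sact x s) (sact y s);
    cong_gam : forall n (k : 'I_n -> nat) (x x' : O n) (y y' : forall i, O (k i)),
      R n x x' -> (forall i, R (k i) (y i) (y' i)) ->
      R (\sum_(i < n) k i)%N (gam x y) (gam x' y') }.

Definition congruence_gen (O : operad) (E : forall n, O n -> O n -> Prop) :
    forall n, O n -> O n -> Prop := fun n x y =>
  forall R : (forall n, O n -> O n -> Prop), is_congruence R ->
    (forall m u v, E m u v -> R m u v) -> R n x y.

Definition is_quotient (O Q : operad) (R : forall n, O n -> O n -> Prop)
    (q : ophom O Q) : Prop :=
  (forall n (z : Q n), exists x, q n x = z) /\
  (forall n (x y : O n), q n x = q n y <-> R n x y).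

(* Both sides live in arity \sum_(a < m) n; variable (a, b) of the left-hand
   side is plugged into variable (b, a) of the right-hand side. *)
Inductive interchange (O P C : operad) (i : ophom O C) (j : ophom P C) :
    forall n, C n -> C n -> Prop :=
  Interchange m n (h : O m) (f : P n) :
    interchange i j (gam (i m h) (fun=> j n f))
      (sact (arcast (sum_swap m n) (gam (j n f) (fun=> i m h))) (swap_perm m n)).

(* q : C -> T exhibits T as the tensor product of O and P, where C is the
   coproduct of O and P, with injections i and j. *)
Definition is_tensor (O P C T : operad) (i : ophom O C) (j : ophom P C)
    (q : ophom C T) : Prop :=
  is_coproduct i j /\ is_quotient (congruence_gen (interchange i j)) q.

Definition is_N_operad (O : operad) : Prop :=
  forall n, (forall (x : O n) (s : 'S_n), sact x s = x -> s = 1) /\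
            (exists x : O n, forall g, gact g x = x).

(* Only the values of [hact] on H are relevant. *)
Record finHset (H : {group G}) := FinHset {
  hset_car :> finType;
  hact : G -> hset_car -> hset_car;
  hact1 : forall x, hact 1 x = x;
  hactM : {in H &, forall h k x, hact (h * k) x = hact h (hact k x)} }.

Definition is_hmap (H : {group G}) (S T : finHset H) (f : S -> T) : Prop :=
  {in H, forall h x, f (hact h x) = hact h (f x)}.

Definition hiso (H : {group G}) (S T : finHset H) : Prop :=
  exists f : S -> T, bijective f /\ is_hmap f.

Definition is_trivial_hset (H : {group G}) (T : finHset H) : Prop :=
  {in H, forall h (x : T), hact h x = x}.

Lemma res_hactM (H K : {group G}) (sKH : K \subset H) (T : finHset H) :
  {in K &, forall h k x, hact (f := T) (h * k) x = hact h (hact k x)}.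
Proof. by move=> h k Kh Kk x; apply: hactM; apply: (subsetP sKH). Qed.

Definition res_hset (H K : {group G}) (sKH : K \subset H) (T : finHset H) :
  finHset K := FinHset (@hact1 _ T) (res_hactM sKH (T := T)).

(* The conjugate subgroup g H g^-1 is H :^ g^-1 in MathComp. *)
Section Conj.
Variables (H : {group G}) (g : G) (T : finHset H).

Definition conj_hact (x : G) (t : T) : T := hact (x ^ g) t.

Lemma conj_hact1 t : conj_hact 1 t = t.
Proof. by rewrite /conj_hact conj1g hact1. Qed.

Lemma conj_hactM : {in (H :^ g^-1)%G &, forall h k t,
  conj_hact (h * k) t = conj_hact h (conj_hact k t)}.
Proof.
move=> h k; rewrite !mem_conjg !invgK => Hh Hk t.
by rewrite /conj_hact conjMg hactM.
Qed.

Definition conj_hset : finHset (H :^ g^-1)%G := FinHset conj_hact1 conj_hactM.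
End Conj.

Section Coproduct.
Variables (H : {group G}) (J : finType) (T : J -> finHset H).

Definition coprod_hact (h : G) (x : {j : J & T j}) : {j : J & T j} :=
  Tagged (fun j => hset_car (T j)) (hact h (tagged x)).

Lemma coprod_hact1 x : coprod_hact 1 x = x.
Proof. by case: x => j t; rewrite /coprod_hact /= hact1. Qed.

Lemma coprod_hactM : {in H &, forall h k x,
  coprod_hact (h * k) x = coprod_hact h (coprod_hact k x)}.
Proof. by move=> h k Hh Hk [j t]; rewrite /coprod_hact /= hactM. Qed.

Definition coprod_hset : finHset H := FinHset coprod_hact1 coprod_hactM.
End Coproduct.

(* H/K: the left cosets of K in H, with H acting by left translation. *)
Section CosetHset.
Variables H K : {group G}.

Definition coset_car := {A : {set G} | A \in lcosets K H}.

Definition coset_hact (h : G) (A : coset_car) : coset_car :=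
  insubd A (h *: val A).

Lemma coset_hactE h A : h \in H -> val (coset_hact h A) = h *: val A.
Proof.
move=> Hh; rewrite val_insubd; case: A => A /= /lcosetsP[x Hx ->].
suff -> : h *: (x *: K) \in lcosets K H by [].
by apply/lcosetsP; exists (h * x); rewrite ?lcosetM // groupM.
Qed.

Lemma coset_hact1 A : coset_hact 1 A = A.
Proof. by apply: val_inj; rewrite coset_hactE // lcoset1. Qed.

Lemma coset_hactM : {in H &, forall h k A,
  coset_hact (h * k) A = coset_hact h (coset_hact k A)}.
Proof.
by move=> h k Hh Hk A; apply: val_inj; rewrite !coset_hactE ?groupM // lcosetM.
Qed.

Definition coset_hset : finHset H := FinHset coset_hact1 coset_hactM.
End CosetHset.

(* H x_K T: the set of the classes of H x T modulo (hk, t) ~ (h, kt), k in K. *)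
Section Induction.
Variables (H K : {group G}) (T : finHset K).

Definition ind_class (p : G * T) : {set G * T} :=
  [set (p.1 * k^-1, hact k p.2) | k in K].

Definition ind_car :=
  {A : {set G * T} | A \in [set ind_class p | p in setX H [set: T]]}.

Definition ind_translate (h : G) (A : {set G * T}) : {set G * T} :=
  [set (h * p.1, p.2) | p in A].

Definition ind_hact (h : G) (A : ind_car) : ind_car :=
  insubd A (ind_translate h (val A)).

Lemma ind_translate_class h p :
  ind_translate h (ind_class p) = ind_class (h * p.1, p.2).
Proof.
rewrite /ind_translate /ind_class -imset_comp.
by apply: eq_imset => k /=; rewrite mulgA.
Qed.

Lemma ind_hactE h A : h \in H -> val (ind_hact h A) = ind_translate h (val A).
Proof.
move=> Hh; rewrite val_insubd; case: A => A /= /imsetP[p].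
case: p => [x t] /setXP[Hx _] ->; rewrite ind_translate_class.
by rewrite imset_f // in_setX in_setT andbT /= groupM.
Qed.

Lemma ind_hact1 A : ind_hact 1 A = A.
Proof.
apply: val_inj; rewrite ind_hactE //; case: A => A /= /imsetP[p _ ->].
by rewrite ind_translate_class mul1g -surjective_pairing.
Qed.

Lemma ind_hactM : {in H &, forall h k A,
  ind_hact (h * k) A = ind_hact h (ind_hact k A)}.
Proof.
move=> h k Hh Hk A; apply: val_inj; rewrite !ind_hactE ?groupM //.
by case: A => A /= /imsetP[p _ ->]; rewrite !ind_translate_class /= mulgA.
Qed.

Definition ind_hset : finHset H := FinHset ind_hact1 ind_hactM.
End Induction.

Definition hclass := forall H : {group G}, finHset H -> Prop.

Record is_indexing_system (I : hclass) : Prop := IsIndexingSystem {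
  idx_trivial : forall (H : {group G}) (T : finHset H), is_trivial_hset T -> I H T;
  idx_iso : forall (H : {group G}) (S T : finHset H), hiso S T -> I H S -> I H T;
  idx_conj : forall (H : {group G}) (g : G) (T : finHset H),
    I H T -> I (H :^ g^-1)%G (conj_hset g T);
  idx_res : forall (H K : {group G}) (sKH : K \subset H) (T : finHset H),
    I H T -> I K (res_hset sKH T);
  idx_sub : forall (H : {group G}) (S T : finHset H) (f : S -> T),
    injective f -> is_hmap f -> I H T -> I H S;
  idx_coprod : forall (H : {group G}) (J : finType) (T : J -> finHset H),
    (forall j, I H (T j)) -> I H (coprod_hset T);
  idx_ind : forall (H K : {group G}) (T : finHset K), K \subset H ->
    I K T -> I H (coset_hset H K) -> I H (ind_hset H T) }.

Definition hclass_sub (I J : hclass) : Prop := forall H T, I H T -> J H T.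

Definition hclass_eq (I J : hclass) : Prop := forall H T, I H T <-> J H T.

Definition idx_meet (I J : hclass) : hclass := fun H T => I H T /\ J H T.

Definition idx_join (I J : hclass) : hclass := fun H T =>
  forall L : hclass, is_indexing_system L ->
    hclass_sub I L -> hclass_sub J L -> L H T.

Lemma idx_join_least (I J : hclass) :
  [/\ is_indexing_system (idx_join I J),
      hclass_sub I (idx_join I J), hclass_sub J (idx_join I J) &
      forall L, is_indexing_system L -> hclass_sub I L -> hclass_sub J L ->
        hclass_sub (idx_join I J) L].
Proof.
split=> [|H T IT L _ IL _|H T JT L _ _ JL|L sL IL JL H T]; try exact; auto.
split=> [H T tT|H S T eST jS|H g T jT|H K sKH T jT|H S T f injf mf jT
        |H J' T jT|H K T sKH jT jHK] L sL IL JL.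
- exact: (idx_trivial sL).
- exact: (idx_iso sL eST (jS L sL IL JL)).
- exact: (idx_conj sL g (jT L sL IL JL)).
- exact: (idx_res sL sKH (jT L sL IL JL)).
- exact: (idx_sub sL injf mf (jT L sL IL JL)).
- exact: (idx_coprod sL (fun j => jT j L sL IL JL)).
- exact: (idx_ind sL sKH (jT L sL IL JL) (jHK L sL IL JL)).
Qed.

(* The left action of G x Sigma_n: (g, s) . x = g x s^-1. *)
Definition gsact (O : operad) n (p : G * 'S_n) (x : O n) : O n :=
  sact (gact p.1 x) p.2^-1.

(* The graph of the permutation representation s : H -> Sigma_#|T| obtained by
   numbering T with [enum_val]: s h is the permutation with
   enum_val (s h i) = h (enum_val i). Another numbering gives a conjugate. *)
Definition hgraph (H : {group G}) (T : finHset H) : {set G * 'S_#|T|} :=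
  [set p : G * 'S_#|T| | (p.1 \in H) &&
     [forall i, enum_val (p.2 i) == hact p.1 (enum_val i) :> T]].

Definition admissible (O : operad) : hclass := fun H T =>
  exists x : O #|T|, {in hgraph T, forall p, gsact p x = x}.

Lemma arcast_map (S T : nat -> Type) (f : forall n, S n -> T n) m n (e : m = n)
    (x : S m) : f n (arcast e x) = arcast e (f m x).
Proof. by case: n / e. Qed.

Lemma arcast_pair (S T : nat -> Type) m n (e : m = n) (x : S m) (y : T m) :
  arcast (S := fun n => (S n * T n)%type) e (x, y) = (arcast e x, arcast e y).
Proof. by case: n / e. Qed.

#[local] Obligation Tactic := idtac.

Section ProductOperad.
Variables O P : operad.

Program Definition prod_sym : symseq := {|
  sym_car n := (O n * P n)%type;
  gact n g x := (gact g x.1, gact g x.2);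
  sact n x s := (sact x.1 s, sact x.2 s) |}.
Next Obligation. by move=> n [x y] /=; rewrite !gact1. Qed.
Next Obligation. by move=> n g h [x y] /=; rewrite !gactM. Qed.
Next Obligation. by move=> n [x y] /=; rewrite !sact1. Qed.
Next Obligation. by move=> n [x y] s t /=; rewrite !sactM. Qed.
Next Obligation. by move=> n g [x y] s /=; rewrite !gsactC. Qed.

Program Definition prod_operad : operad := {|
  op_sym := prod_sym;
  opid := (opid O, opid P);
  gam n k x y := (gam x.1 (fun i => (y i).1), gam x.2 (fun i => (y i).2)) |}.
Next Obligation. by move=> g /=; rewrite !gact_id. Qed.
Next Obligation. by move=> n k g x y /=; rewrite !gact_gam. Qed.
Next Obligation. by move=> m [y1 y2] /=; rewrite arcast_pair !gam_idl. Qed.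
Next Obligation. by move=> n [x1 x2] /=; rewrite arcast_pair !gam_idr. Qed.
Next Obligation.
move=> n k l x y z /=; rewrite arcast_pair.
rewrite (gamA (l := l) x.1 _ (fun i j => (z i j).1)).
by rewrite (gamA (l := l) x.2 _ (fun i j => (z i j).2)).
Qed.
Next Obligation.
move=> n k x s y /=; rewrite arcast_pair /=.
rewrite (gam_sactl x.1 s (fun i => (y i).1)).
by rewrite (gam_sactl x.2 s (fun i => (y i).2)).
Qed.
Next Obligation. by move=> n k x y t /=; rewrite !gam_sactr. Qed.

Lemma fst_ophom : @is_ophom prod_operad O (fun n x => x.1).
Proof. by []. Qed.
Lemma snd_ophom : @is_ophom prod_operad P (fun n x => x.2).
Proof. by []. Qed.
End ProductOperad.

Lemma product_exists (O P : operad) :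
  exists (X : operad) (p : ophom X O) (q : ophom X P), is_product p q.
Proof.
exists (prod_operad O P), (Ophom (@fst_ophom O P)), (Ophom (@snd_ophom O P)).
move=> Z f g.
have hP : @is_ophom Z (prod_operad O P) (fun n z => (f n z, g n z)).
  case: (ophomP f) (ophomP g) => [[fg fs] f1 fm] [[gg gs] g1 gm].
  by split=> [|/=|n k x y /=]; rewrite ?f1 ?g1 ?fm ?gm //; split=> /= *;
     rewrite ?fg ?fs ?gg ?gs.
exists (Ophom hP); split=> // h' h'P n z /=.
by case: (h'P n z) => <- <-; case: (h' n z).
Qed.

(* The quotient of a set of operations D by a relation R modulo which the
   axioms of operads hold. *)
Section QuotientOperad.
Variables (D : nat -> Type) (dg : forall n, G -> D n -> D n).
Variables (ds : forall n, D n -> 'S_n -> D n) (d1 : D 1%N).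
Variable dm : forall n (k : 'I_n -> nat),
  D n -> (forall i, D (k i)) -> D (\sum_(i < n) k i)%N.
Variable R : forall n, D n -> D n -> Prop.
Hypothesis Rxx : forall n (x : D n), R x x.
Hypothesis Rsym : forall n (x y : D n), R x y -> R y x.
Hypothesis Rtr : forall n (x y z : D n), R x y -> R y z -> R x z.
Hypothesis Rg : forall n g (x y : D n), R x y -> R (dg g x) (dg g y).
Hypothesis Rs : forall n (x y : D n) s, R x y -> R (ds x s) (ds y s).
Hypothesis Rm : forall n (k : 'I_n -> nat) (x x' : D n) (y y' : forall i, D (k i)),
  R x x' -> (forall i, R (y i) (y' i)) -> R (dm x y) (dm x' y').
Hypothesis Rg1 : forall n (x : D n), R (dg 1 x) x.
Hypothesis RgM : forall n g h (x : D n), R (dg (g * h) x) (dg g (dg h x)).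
Hypothesis Rs1 : forall n (x : D n), R (ds x 1) x.
Hypothesis RsM : forall n (x : D n) s t, R (ds x (t * s)) (ds (ds x s) t).
Hypothesis RgsC : forall n g (x : D n) s, R (dg g (ds x s)) (ds (dg g x) s).
Hypothesis Rgid : forall g, R (dg g d1) d1.
Hypothesis Rgm : forall n (k : 'I_n -> nat) g (x : D n) (y : forall i, D (k i)),
  R (dg g (dm x y)) (dm (dg g x) (fun i => dg g (y i))).
Hypothesis Ridl : forall m (y : D m), R (arcast (sum_one m) (dm d1 (fun=> y))) y.
Hypothesis Ridr : forall n (x : D n), R (arcast (sum_ones n) (dm x (fun=> d1))) x.
Hypothesis RmA : forall n (k : 'I_n -> nat) (l : forall i, 'I_(k i) -> nat)
  (x : D n) (y : forall i, D (k i)) (z : forall i j, D (l i j)),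
  R (arcast (sum_sum l) (dm (dm x y) (fun a => z (rk1 a) (rk2 a))))
    (dm x (fun i => dm (y i) (z i))).
Hypothesis Rml : forall n (k : 'I_n -> nat) (x : D n) (s : 'S_n)
  (y : forall i, D (k i)),
  R (dm (ds x s) (fun i => y (s i)))
    (ds (arcast (sum_perm k s) (dm x y)) (block_perm k s)).
Hypothesis Rmr : forall n (k : 'I_n -> nat) (x : D n) (y : forall i, D (k i))
  (t : forall i, 'S_(k i)),
  R (dm x (fun i => ds (y i) (t i))) (ds (dm x y) (dsum_perm t)).

Definition qcar n := {c : D n -> Prop | exists x, c = @R n x}.
Definition qcl n (x : D n) : qcar n := exist _ (@R n x) (ex_intro _ x erefl).
Definition qrep n (c : qcar n) : D n := sval (cid (svalP c)).

Lemma qclP n (x y : D n) : qcl x = qcl y <-> R x y.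
Proof.
split=> [/(congr1 sval) /= ->|Rxy]; first exact: Rxx.
apply: eq_exist; apply: functional_extensionality_dep => z; apply: propext.
by split; apply: Rtr => //; apply: Rsym.
Qed.

Lemma qrepK n (c : qcar n) : qcl (qrep c) = c.
Proof.
rewrite /qrep; case: cid => x /=; case: c => A eA /= defA.
by apply: eq_exist; rewrite defA.
Qed.

Lemma R_qrep n (x : D n) : R (qrep (qcl x)) x.
Proof. by apply/qclP; rewrite qrepK. Qed.

Lemma qclW n (Pr : qcar n -> Prop) : (forall x, Pr (qcl x)) -> forall c, Pr c.
Proof. by move=> Prx c; rewrite -(qrepK c). Qed.

Lemma qclW_fam n (k : 'I_n -> nat) (Pr : (forall i, qcar (k i)) -> Prop) :
  (forall y : forall i, D (k i), Pr (fun i => qcl (y i))) -> forall c, Pr c.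
Proof.
move=> Pry c; have -> : c = fun i => qcl (qrep (c i)).
  by apply: functional_extensionality_dep => i; rewrite qrepK.
exact: Pry.
Qed.

Definition qg n g (c : qcar n) := qcl (dg g (qrep c)).
Definition qs n (c : qcar n) s := qcl (ds (qrep c) s).
Definition qm n (k : 'I_n -> nat) (c : qcar n) (b : forall i, qcar (k i)) :=
  qcl (dm (qrep c) (fun i => qrep (b i))).

Lemma qgE n g (x : D n) : qg g (qcl x) = qcl (dg g x).
Proof. by apply/qclP; apply: Rg; apply: R_qrep. Qed.
Lemma qsE n (x : D n) s : qs (qcl x) s = qcl (ds x s).
Proof. by apply/qclP; apply: Rs; apply: R_qrep. Qed.
Lemma qmE n (k : 'I_n -> nat) (x : D n) (y : forall i, D (k i)) :
  qm (qcl x) (fun i => qcl (y i)) = qcl (dm x y).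
Proof. by apply/qclP; apply: Rm => [|i]; apply: R_qrep. Qed.

Program Definition quot_sym : symseq :=
  {| sym_car := qcar; gact := qg; sact := qs |}.
Next Obligation. by move=> n; elim/qclW=> x; rewrite qgE; apply/qclP. Qed.
Next Obligation. by move=> n g h; elim/qclW=> x; rewrite !qgE; apply/qclP. Qed.
Next Obligation. by move=> n; elim/qclW=> x; rewrite qsE; apply/qclP. Qed.
Next Obligation. by move=> n; elim/qclW=> x s t; rewrite !qsE; apply/qclP. Qed.
Next Obligation.
by move=> n g; elim/qclW=> x s; rewrite qsE !qgE qsE; apply/qclP.
Qed.

Program Definition quot_operad : operad :=
  {| op_sym := quot_sym; opid := qcl d1; gam := qm |}.
Next Obligation. by move=> g; rewrite /= qgE; apply/qclP. Qed.
Next Obligation.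
move=> n k g /=; elim/qclW=> x; elim/qclW_fam=> y; rewrite qmE !qgE.
under [X in qm _ X]functional_extensionality_dep do rewrite qgE.
by rewrite qmE; apply/qclP; apply: Rgm.
Qed.
Next Obligation.
move=> m /=; elim/qclW=> y.
by rewrite (qmE d1 (fun=> y)) -(arcast_map qcl); apply/qclP; apply: Ridl.
Qed.
Next Obligation.
move=> n /=; elim/qclW=> x.
by rewrite (qmE x (fun=> d1)) -(arcast_map qcl); apply/qclP; apply: Ridr.
Qed.
Next Obligation.
move=> n k l /=; elim/qclW=> x; elim/qclW_fam=> y z.
pose w i j := qrep (z i j).
have -> : z = fun i j => qcl (w i j).
  by do 2!apply: functional_extensionality_dep => ?; rewrite qrepK.
have -> : (fun i => qm (qcl (y i)) (fun j => qcl (w i j)))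
  = (fun i => qcl (dm (y i) (w i))).
  by apply: functional_extensionality_dep => i; rewrite qmE.
rewrite !qmE -(arcast_map qcl).
by apply/qclP; apply: RmA.
Qed.
Next Obligation.
move=> n k /=; elim/qclW=> x s; elim/qclW_fam=> y.
rewrite qsE !qmE -(arcast_map qcl) qsE.
by apply/qclP; apply: Rml.
Qed.
Next Obligation.
move=> n k /=; elim/qclW=> x; elim/qclW_fam=> y t.
have -> : (fun i => qs (qcl (y i)) (t i)) = (fun i => qcl (ds (y i) (t i))).
  by apply: functional_extensionality_dep => i; rewrite qsE.
by rewrite !qmE qsE; apply/qclP; apply: Rmr.
Qed.

Lemma quot_operad_exists : exists (Q : operad) (q : forall n, D n -> Q n),
  (forall n z, exists x, q n x = z) /\ (forall n x y, q n x = q n y <-> @R n x y) /\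
  [/\ forall n g x, q n (dg g x) = gact g (q n x),
      forall n x s, q n (ds x s) = sact (q n x) s, q 1%N d1 = opid Q &
      forall n (k : 'I_n -> nat) (x : D n) (y : forall i, D (k i)),
        q _ (dm x y) = gam (q n x) (fun i => q (k i) (y i))].
Proof.
exists quot_operad, qcl; split=> [n z|]; first by exists (qrep z); rewrite qrepK.
split=> [n x y|]; first exact: qclP.
split=> [n g x|n x s||n k x y] //; first by rewrite /= qgE.
  by rewrite /= qsE.
by rewrite /= qmE.
Qed.

End QuotientOperad.

Lemma congruence_genP (O : operad) (E : forall n, O n -> O n -> Prop) :
  is_congruence (congruence_gen E) /\
  (forall n x y, E n x y -> congruence_gen E x y).
Proof.
split=> [|n x y Exy R cR ER]; last exact: ER.
split=> [n x R cR _|n x y Rxy R cR ER|n x y z Rxy Ryz R cR ER|n g x y Rxy R cR ER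
        |n x y s Rxy R cR ER|n k x x' y y' Rx Ry R cR ER].
- exact: (cong_refl cR).
- by apply: (cong_sym cR); apply: Rxy.
- by apply: (cong_trans cR (Rxy R cR ER) (Ryz R cR ER)).
- by apply: (cong_gact cR); apply: Rxy.
- by apply: (cong_sact cR); apply: Rxy.
- by apply: (cong_gam cR) => [|i]; [apply: Rx | apply: Ry].
Qed.

Lemma quotient_exists (O : operad) (R : forall n, O n -> O n -> Prop) :
  is_congruence R -> exists (Q : operad) (q : ophom O Q), is_quotient R q.
Proof.
case=> Rxx Rsym Rtr Rg Rs Rm.
have Req n (x y : O n) : x = y -> R n x y by move=> ->; apply: Rxx.
have [Q [q [qsurj [qker [qg' qs' q1 qm']]]]] :=
  @quot_operad_exists O (@gact O) (@sact O) (opid O) (@gam O) R Rxx Rsym Rtr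
    Rg Rs Rm
    (fun n x => Req _ _ _ (gact1 x)) (fun n g h x => Req _ _ _ (gactM g h x))
    (fun n x => Req _ _ _ (sact1 x)) (fun n x s t => Req _ _ _ (sactM x s t))
    (fun n g x s => Req _ _ _ (gsactC g x s)) (fun g => Req _ _ _ (gact_id O g))
    (fun n k g x y => Req _ _ _ (gact_gam g x y))
    (fun m y => Req _ _ _ (gam_idl y)) (fun n x => Req _ _ _ (gam_idr x))
    (fun n k l x y z => Req _ _ _ (gamA x y z))
    (fun n k x s y => Req _ _ _ (gam_sactl x s y))
    (fun n k x y t => Req _ _ _ (gam_sactr x y t)).
have qP : is_ophom q by split.
by exists Q, (Ophom qP).
Qed.

(* The operad presented by generators [gen] and the relations that hold under
   all the interpretations of [gen] satisfying [ok]. *)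
Section Presentation.
Variable gen : nat -> Type.

Inductive term : nat -> Type :=
| Tgen n of gen n : term n
| Tgact n of G & term n : term n
| Tsact n of term n & 'S_n : term n
| Tid : term 1%N
| Tgam n (k : 'I_n -> nat) of term n & (forall i, term (k i)) :
    term (\sum_(i < n) k i)%N.

Fixpoint tval (Z : operad) (f : forall n, gen n -> Z n) n (t : term n) : Z n :=
  match t in term n return Z n with
  | Tgen n x => f n x
  | Tgact n g t => gact g (tval f t)
  | Tsact n t s => sact (tval f t) s
  | Tid => opid Z
  | Tgam n k t u => gam (tval f t) (fun i => tval f (u i))
  end.

Variable ok : forall Z : operad, (forall n, gen n -> Z n) -> Prop.

Lemma presented_exists : exists (C : operad) (q : forall n, term n -> C n),
  [/\ forall n (t u : term n), (forall Z f, @ok Z f -> tval f t = tval f u) ->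
        q n t = q n u,
      forall n g t, q n (Tgact g t) = gact g (q n t),
      forall n t s, q n (Tsact t s) = sact (q n t) s,
      q 1%N Tid = opid C &
      forall n (k : 'I_n -> nat) (t : term n) (u : forall i, term (k i)),
        q _ (Tgam t u) = gam (q n t) (fun i => q (k i) (u i))] /\
  (forall (Z : operad) f, @ok Z f -> exists h : ophom C Z,
     (forall n x, h n (q n (Tgen x)) = f n x) /\
     (forall h' : ophom C Z, (forall n x, h' n (q n (Tgen x)) = f n x) ->
        forall n z, h' n z = h n z)).
Proof.
pose R n (t u : term n) := forall Z f, @ok Z f -> tval f t = tval f u.
have tvalc (Z : operad) f m n (e : m = n) t :
  tval f (arcast e t) = arcast e (tval f t) :> Z n by rewrite (arcast_map (tval f)).
have eqf n (k : 'I_n -> nat) (D : nat -> Type) (u v : forall i, D (k i)) :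
    (forall i, u i = v i) -> u = v by apply: functional_extensionality_dep.
have [||||||||||||||||||C [q [qsurj [qker [qg' qs' q1 qm']]]]] :=
  @quot_operad_exists term Tgact Tsact Tid Tgam R.
- by [].
- by move=> n x y Rxy Z f okf; rewrite Rxy.
- by move=> n x y z Rxy Ryz Z f okf; rewrite Rxy // Ryz.
- by move=> n g x y Rxy Z f okf /=; rewrite (Rxy Z f).
- by move=> n x y s Rxy Z f okf /=; rewrite (Rxy Z f).
- move=> n k x x' y y' Rx Ry Z f okf /=; rewrite (Rx Z f) //; congr gam.
  by apply: eqf => i; apply: Ry.
- by move=> n x Z f _ /=; rewrite gact1.
- by move=> n g h x Z f _ /=; rewrite gactM.
- by move=> n x Z f _ /=; rewrite sact1.
- by move=> n x s t Z f _ /=; rewrite sactM.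
- by move=> n g x s Z f _ /=; rewrite gsactC.
- by move=> g Z f _ /=; rewrite gact_id.
- by move=> n k g x y Z f _ /=; rewrite gact_gam.
- by move=> m y Z f _; rewrite tvalc /= gam_idl.
- by move=> n x Z f _; rewrite tvalc /= gam_idr.
- move=> n k l x y z Z f _; rewrite tvalc /=.
  exact: (gamA (l := l) (tval f x) (fun i => tval f (y i))
           (fun i j => tval f (z i j))).
- move=> n k x s y Z f _ /=; rewrite tvalc /=.
  exact: (gam_sactl (tval f x) s (fun i => tval f (y i))).
- by move=> n k x y t Z f _ /=; rewrite gam_sactr.
exists C, q; split=> [|Z f okf]; first by split=> // n t u /qker.
pose h n (z : C n) : Z n := tval f (sval (cid (qsurj n z))).
have hE n t : h n (q n t) = tval f t.
  by rewrite /h; case: cid => u /= /qker; apply.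
have hP : is_ophom h.
  split=> [||n k x y]; first split=> [n g x|n x s].
  - by have [t <-] := qsurj n x; rewrite -qg' !hE.
  - by have [t <-] := qsurj n x; rewrite -qs' !hE.
  - by rewrite -q1 hE.
  have [t <-] := qsurj n x.
  have [u ->] : exists u : forall i, term (k i), y = fun i => q _ (u i).
    exists (fun i => sval (cid (qsurj _ (y i)))).
    by apply: eqf => i; case: cid.
  rewrite -qm' !hE /=; congr gam.
  by apply: eqf => i; rewrite hE.
exists (Ophom hP); split=> [n x|h' h'P n z] /=; first exact: hE.
have [t <-] := qsurj n z; rewrite hE.
have [[h'g h's] h'1 h'm] := ophomP h'.
elim: t => {n z} [n x|n g t IH|n t IH s||n k t IHt u IHu] /=.
- exact: h'P.
- by rewrite qg' h'g IH.
- by rewrite qs' h's IH.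
- by rewrite q1 h'1.
rewrite qm' h'm IHt; congr gam.
by apply: eqf => i.
Qed.
End Presentation.

Lemma free_exists (S : symseq) :
  exists (F : operad) (eta : symhom S F), is_free_on eta.
Proof.
have [F [q [[qeq qg qs _ _] quniv]]] := presented_exists (fun Z => @is_symhom S Z).
have etaP : @is_symhom S F (fun n x => q n (Tgen x)).
  split=> [n g x|n x s]; rewrite -?qg -?qs; apply: qeq => Z f [fg fs] /=.
    by rewrite fg.
  by rewrite fs.
exists F, (Symhom etaP) => Z f.
have [h [hq huniq]] := quniv Z f (symhomP f).
by exists h.
Qed.

Lemma coproduct_exists (O P : operad) :
  exists (C : operad) (i : ophom O C) (j : ophom P C), is_coproduct i j.
Proof.
pose ok (Z : operad) (f : forall n, (O n + P n)%type -> Z n) :=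
  is_ophom (fun n x => f n (inl x)) /\ is_ophom (fun n y => f n (inr y)).
have [C [q [[qeq qg qs q1 qm] quniv]]] := presented_exists ok.
have iP : @is_ophom O C (fun n x => q n (Tgen (inl x))).
  by split=> [|/=|n k x y]; rewrite -?q1 -?qm; first split=> [n g x|n x s];
     rewrite -?qg -?qs; apply: qeq => Z f [[[fg fs] f1 fm] _] /=;
     rewrite ?fg ?fs ?f1 ?fm.
have jP : @is_ophom P C (fun n x => q n (Tgen (inr x))).
  by split=> [|/=|n k x y]; rewrite -?q1 -?qm; first split=> [n g x|n x s];
     rewrite -?qg -?qs; apply: qeq => Z f [_ [[fg fs] f1 fm]] /=;
     rewrite ?fg ?fs ?f1 ?fm.
exists C, (Ophom iP), (Ophom jP) => Z f g.
pose fg n (x : O n + P n) : Z n := match x with inl x => f n x | inr y => g n y end.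
have [|h [hq huniq]] := quniv Z fg.
  by split; [apply: ophomP f | apply: ophomP g].
exists h; split=> [|h' [h'f h'g]]; first by split=> n x; apply: hq.
by apply: huniq => n [x|y]; [apply: h'f | apply: h'g].
Qed.

Lemma tensor_exists (O P : operad) :
  exists (C T : operad) (i : ophom O C) (j : ophom P C) (q : ophom C T),
    is_tensor i j q.
Proof.
have [C [i [j ijC]]] := coproduct_exists O P.
have [T [q qT]] := quotient_exists (congruence_genP (interchange i j)).1.
by exists C, T, i, j, q.
Qed.

End Operads.

Arguments is_congruence {G O} R.
Arguments admissible {G} O H T.

(* Main.v *)
Require Import Defs.
From HB Require Import structures.
From mathcomp Require Import all_boot all_order all_fingroup.
From mathcomp Require Import boolp.
(* all_fingroup also exports an identifier [gact]. *)
Import Defs.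

Set Implicit Arguments.
Unset Strict Implicit.
Unset Printing Implicit Defensive.

Import GroupScope.

#[local] Obligation Tactic := idtac.

(* Modulo reindexing of its inputs, an operation of O whose inputs are labelled
   by Y is an element of the free O-algebra on Y, and an H-set T is admissible
   when some operation labelled bijectively by T is fixed by H in the free
   algebra on T. So A(O) is an indexing system when every O(n) has a G-fixed
   point, and morphisms of operads can only enlarge A(O). It remains to see that
   the coproduct C and the tensor product T of O and P are Sigma-free, and that
   their admissible sets lie in any indexing system L containing A(O) and A(P).

   Coproduct: the alternating reduced trees with leaves in a G-set X form an
   algebra over O and P, hence over C. If H fixes a tree whose leaves are
   distinct, it acts on the inputs of the root, which form an admissible set,
   and the stabilizer of an input fixes the subtree there; by induction the set
   of the leaves is in L. A similar induction shows that a permutation of X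
   fixing a tree fixes its leaves.

   Tensor product: O and P map to free operads F(S) and F(S'). Sending a tree
   on the generators to the family of the paths from its root to its inputs, a
   path being recorded by the word of its edges in S and the word of its edges
   in S', gives a morphism from C to an operad of families of pairs of words.
   Edges in S commute with edges in S', so the interchange relations hold
   there. The first letter of a path still determines the root, whence the same
   induction as above on an H-stable set of paths. *)

(** * Ranks in iterated sums *)

Lemma sum_one_cast m (a : 'I_(\sum_(i < 1) m)) : cast_ord (sum_one m) a = rk2 a.
Proof.
apply: val_inj; rewrite /= tagnat.rect big_pred0 // => i.
by rewrite [rk1 a]ord1 ltn0.
Qed.

Lemma sum_ones_cast n (a : 'I_(\sum_(i < n) 1)) : cast_ord (sum_ones n) a = rk1 a.
Proof.
apply: val_inj; rewrite /= tagnat.rect [rk2 a]ord1 addn0.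
by rewrite -(big_ord_widen n (fun=> 1%N) (ltnW (ltn_ord _))) sum1_card card_ord.
Qed.

Lemma ltn_rank n (k : 'I_n -> nat) (p q : {i & 'I_(k i)}) :
  (tagnat.rank p < tagnat.rank q)%N =
  (tag p < tag q)%N || (tag p == tag q) && (tagged p < tagged q)%N.
Proof.
have h := @tagnat.lt_rank _ k p q; rewrite Order.OrdinalOrder.ltEord in h; rewrite {}h.
case: p q => i j [i' j']; rewrite Order.SigmaOrder.ltEsig /= Order.OrdinalOrder.ltEord
  Order.OrdinalOrder.leEord.
case: (ltngtP i i') => [lt|lt|/val_inj ei]; rewrite ?orbF //=.
  by rewrite -val_eqE gtn_eqF.
by case: _ / ei j' => j'; rewrite tagged_asE eqxx.
Qed.

(** Both numbers count the inputs that come before [a]. In the lexicographic order, the blocks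
    before the pair (i, j) are those with a smaller first index, and those with first index i and a
    smaller second index. *)
Lemma sum_sum_cast n (k : 'I_n -> nat) (l : forall i, 'I_(k i) -> nat)
    (a : 'I_(\sum_(b < \sum_(i < n) k i) l (rk1 b) (rk2 b))) :
  cast_ord (sum_sum l) a
  = @rk _ (fun i => (\sum_(j < k i) l i j)%N) (rk1 (rk1 a))
      (@rk _ (l (rk1 (rk1 a))) (rk2 (rk1 a)) (rk2 a)).
Proof.
apply: ord_inj; transitivity (a : nat) => //.
rewrite !tagnat.RankEsum addnA [LHS]tagnat.rect; congr addn.
set b := rk1 a; set i := rk1 b; set j := rk2 b.
rewrite (reindex _ (onW_bij _ (@tagnat.rank_bij n k))).
transitivity (\sum_(p : {i & 'I_(k i)} |
  (tag p < i)%N || (tag p == i) && (tagged p < j)%N) l (tag p) (tagged p))%N.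
  apply: eq_big => [p|[i' j'] _]; last exact: (rkK l).
  by rewrite -[in LHS](tagnat.sigK b) ltn_rank.
rewrite [LHS](bigID (fun p : {i & 'I_(k i)} => (tag p < i)%N)) /=; congr addn.
  rewrite sig_big_dep /=; apply: eq_bigl => p.
  by rewrite andbT; case: ltnP; rewrite ?andbF.
rewrite (eq_bigl (fun p : {i & 'I_(k i)} => (tag p == i) && (tagged p < j)%N)); last first.
  move=> p /=; case: ltnP => //= h; last by rewrite andbT.
  by apply/esym/negbTE; rewrite negb_and -val_eqE ltn_eqF.
rewrite -(sig_big_dep (fun i' => i' == i)
  (fun i' (j' : 'I_(k i')) => (j' < j)%N) (fun i' j' => l i' j')) /=.
by rewrite big_pred1_eq.
Qed.

Lemma sum_rk n (k : 'I_n -> nat) (w : 'I_(\sum_(i < n) k i) -> nat) :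
  (\sum_a w a = \sum_(i < n) \sum_(j < k i) w (rk i j))%N.
Proof.
rewrite sig_big_dep /= (reindex _ (@tagnat.sig_bij_on n k)) /=.
by apply: eq_bigr => a _; rewrite -[in LHS](tagnat.sig2K a).
Qed.

(** * Operations with labelled inputs *)

Section LabelledOperations.
Variables (G : finGroupType) (O : operad G).

(* Modulo [lequiv], these are the elements of the free O-algebra on Y. *)
Record lop (Y : Type) := Lop { ar : nat; opn : O ar; lab : 'I_ar -> Y }.
Arguments lab {Y} u i : rename.

Definition lequiv Y (u v : lop Y) : Prop :=
  exists s : 'S_(ar v), u = Lop (sact (opn v) s) (fun i => lab v (s i)).

Definition lunit Y (y : Y) : lop Y := Lop (opid O) (fun=> y).

Definition lmul Y n (x : O n) (u : 'I_n -> lop Y) : lop Y :=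
  Lop (gam x (fun i => opn (u i))) (fun a => lab (u (rk1 a)) (rk2 a)).

Definition lmap Y Z (g : G) (f : Y -> Z) (u : lop Y) : lop Z :=
  Lop (gact g (opn u)) (fun i => f (lab u i)).

Definition lsum Y (w : Y -> nat) (u : lop Y) : nat :=
  (\sum_(i < ar u) w (lab u i))%N.

Lemma Lop_inj Y n (x y : O n) (b d : 'I_n -> Y) : Lop x b = Lop y d -> x = y /\ b = d.
Proof.
(* Quantifying over the equality of arities lets [E] be rewritten; the equality then has type n = n
   and is [erefl] by irrelevance. *)
pose P (u : lop Y) (v : lop Y) := forall e : ar v = ar u,
  opn u = arcast e (opn v) /\ lab u = fun i => lab v (cast_ord (esym e) i).
move=> E; have : P (Lop x b) (Lop y d).
  rewrite E => e /=; rewrite (eq_irrelevance e erefl) /=; split=> //.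
  by apply/funext => i; rewrite cast_ord_id.
move=> /(_ erefl) [/= -> ->]; split=> //.
by apply/funext => i /=; rewrite cast_ord_id.
Qed.

Lemma Lop_ext Y n (x y : O n) (b d : 'I_n -> Y) : x = y -> b =1 d -> Lop x b = Lop y d.
Proof. by move=> -> /funext ->. Qed.

Lemma Lop_cast Y m n (e : m = n) (x : O m) (b : 'I_m -> Y) (d : 'I_n -> Y) :
  (forall i, b i = d (cast_ord e i)) -> Lop x b = Lop (arcast e x) d.
Proof.
by case: n / e d => d bd; apply: Lop_ext => // i; rewrite bd cast_ord_id.
Qed.

Lemma lopE Y (u : lop Y) : Lop (opn u) (lab u) = u. Proof. by case: u. Qed.

Lemma lequivP Y n (x y : O n) (b d : 'I_n -> Y) :
  lequiv (Lop x b) (Lop y d) <-> exists s : 'S_n, x = sact y s /\ forall i, b i = d (s i).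
Proof.
split=> [[s /= /Lop_inj[-> ->]]|[s [-> bd]]]; first by exists s.
by exists s; apply: Lop_ext.
Qed.

Lemma lequiv_refl Y (u : lop Y) : lequiv u u.
Proof.
by exists 1; case: u => n x b /=; apply: Lop_ext => [|i]; rewrite ?sact1 ?perm1.
Qed.

Lemma lequiv_sym Y (u v : lop Y) : lequiv u v -> lequiv v u.
Proof.
case: v => n x b [s /= ->]; exists s^-1 => /=; apply: Lop_ext => [|i].
  by rewrite -sactM mulVg sact1.
by rewrite permKV.
Qed.

Lemma lequiv_trans Y (v u w : lop Y) : lequiv u v -> lequiv v w -> lequiv u w.
Proof.
case: w => n x b [s us] [t vt]; move: us; rewrite {}vt {v} in s * => /= ->.
by apply/lequivP; exists (s * t); split=> [|i]; rewrite ?sactM ?permM.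
Qed.

Lemma lequiv_lunit Y (y z : Y) : lequiv (lunit y) (lunit z) -> y = z.
Proof. by case/lequivP => s [_ /(_ ord0)]. Qed.

Lemma lequiv_lab Y (u v : lop Y) i : lequiv u v -> exists j, lab u i = lab v j.
Proof. by case: v => n x b [s us]; move: i; rewrite us => i; exists (s i). Qed.

Lemma lequiv_lmap Y Z g (f : Y -> Z) u v :
  lequiv u v -> lequiv (lmap g f u) (lmap g f v).
Proof. by case=> s ->; exists s; apply: Lop_ext => //=; rewrite gsactC. Qed.

Lemma lmap_comp Y Z W g h (f : Z -> W) (e : Y -> Z) u :
  lmap g f (lmap h e u) = lmap (g * h) (fun y => f (e y)) u.
Proof. by apply: Lop_ext => //=; rewrite gactM. Qed.

Lemma eq_lmap Y Z g (f e : Y -> Z) u :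
  (forall i, f (lab u i) = e (lab u i)) -> lmap g f u = lmap g e u.
Proof. by move=> fe; apply: Lop_ext. Qed.

Lemma lmap_lunit Y Z g (f : Y -> Z) y : lmap g f (lunit y) = lunit (f y).
Proof. by apply: Lop_ext => //=; rewrite gact_id. Qed.

Lemma lmap_lmul Y Z g (f : Y -> Z) n (x : O n) u :
  lmap g f (lmul x u) = lmul (gact g x) (fun i => lmap g f (u i)).
Proof. by apply: Lop_ext => //=; rewrite gact_gam. Qed.

Lemma lmul_idl Y (u : lop Y) : lmul (opid O) (fun=> u) = u.
Proof.
case: u => m x b; rewrite -[X in _ = Lop X _]gam_idl.
by apply: Lop_cast => i /=; rewrite sum_one_cast.
Qed.

Lemma lmulA Y n (k : 'I_n -> nat) (x : O n) (y : forall i, O (k i))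
    (u : forall i, 'I_(k i) -> lop Y) :
  lmul (gam x y) (fun a => u (rk1 a) (rk2 a)) = lmul x (fun i => lmul (y i) (u i)).
Proof.
rewrite /lmul /=.
rewrite -(@gamA _ _ _ k (fun i j => ar (u i j)) x y (fun i j => opn (u i j))).
apply: Lop_cast => a; rewrite sum_sum_cast.
rewrite (rkK (fun i c => lab (u i (rk1 c)) (rk2 c))).
by rewrite (rkK (fun j c => lab (u _ j) c)).
Qed.

(** The block permutation in the equivariance axiom only renumbers the inputs of the composite, so
    [lequiv] absorbs it. *)
Lemma lmul_sactl Y n (x : O n) (s : 'S_n) (u : 'I_n -> lop Y) :
  lequiv (lmul (sact x s) (fun i => u (s i))) (lmul x u).
Proof.
rewrite /lmul /= (gam_sactl x s (fun i => opn (u i))).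
pose d (a : 'I_(\sum_(i < n) ar (u i))) := lab (u (rk1 a)) (rk2 a).
rewrite (@Lop_cast Y _ _ (sum_perm (fun i => ar (u i)) s) _ d
  (fun a => d (cast_ord (esym (sum_perm _ s)) a))) => [|i]; last by rewrite cast_ordK.
apply/lequivP; exists (block_perm (fun i => ar (u i)) s); split=> // a.
rewrite permE /block_fun cast_ordK /d.
by rewrite (rkK (fun i c => lab (u i) c)).
Qed.

Lemma lmul_ext Y n (x : O n) (u v : 'I_n -> lop Y) :
  (forall i, lequiv (u i) (v i)) -> lequiv (lmul x u) (lmul x v).
Proof.
move=> uv; pose t i := sval (cid (uv i)).
have -> : u = fun i => Lop (sact (opn (v i)) (t i)) (fun j => lab (v i) (t i j)).
  by apply/funext => i; rewrite /t; case: cid.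
rewrite /lmul /= (gam_sactr x (fun i => opn (v i)) t).
apply/lequivP; exists (dsum_perm t); split=> // a.
by rewrite permE /dsum_fun (rkK (fun i c => lab (v i) c)).
Qed.

(** If h x = x s and h carries u_i to u_(s i), then h carries x(u) to (x s)(u o s), which is
    equivalent to x(u). *)
Lemma lmul_fix Y (H : {set G}) n (x : O n) (u : 'I_n -> lop Y) (f : G -> Y -> Y) :
  (forall h, h \in H -> exists s : 'S_n,
     gact h x = sact x s /\ forall i, lequiv (lmap h (f h) (u i)) (u (s i))) ->
  forall h, h \in H -> lequiv (lmap h (f h) (lmul x u)) (lmul x u).
Proof.
move=> fixu h /fixu[s [xs us]]; rewrite lmap_lmul xs.
apply: lequiv_trans (lmul_sactl x s u); exact: lmul_ext.
Qed.

Lemma lsum_lequiv Y (w : Y -> nat) u v : lequiv u v -> lsum w u = lsum w v.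
Proof.
by case=> s ->; rewrite /lsum /= [RHS](reindex_inj (@perm_inj _ s)).
Qed.

Lemma lsum_lunit Y (w : Y -> nat) y : lsum w (lunit y) = w y.
Proof. by rewrite /lsum /= big_ord1. Qed.

Lemma lsum_lmul Y (w : Y -> nat) n (x : O n) u :
  lsum w (lmul x u) = (\sum_(i < n) lsum w (u i))%N.
Proof.
rewrite /lsum /= sig_big_dep /=.
by rewrite (reindex _ (@tagnat.sig_bij_on n (fun i => ar (u i)))).
Qed.

End LabelledOperations.
Arguments lab {G O Y} u i : rename.

(** * Admissible sets *)

Section Hsets.
Variable G : finGroupType.

Lemma hactK (H : {group G}) (T : finHset H) h : h \in H ->
  cancel (hact (f := T) h) (hact (f := T) h^-1).
Proof. by move=> Hh t; rewrite -hactM ?groupV // mulVg hact1. Qed.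

Lemma hactKV (H : {group G}) (T : finHset H) h : h \in H ->
  cancel (hact (f := T) h^-1) (hact (f := T) h).
Proof. by move=> Hh t; rewrite -hactM ?groupV // mulgV hact1. Qed.

Lemma hact_inj (H : {group G}) (T : finHset H) h : h \in H ->
  injective (hact (f := T) h).
Proof. by move/(@hactK _ T)/can_inj. Qed.

Section InducedClasses.
Variables (H K : {group G}) (T : finHset K).

Lemma ind_class1_subproof (t : T) :
  ind_class (1 : G, t) \in [set ind_class p | p in setX H [set: T]].
Proof. by rewrite imset_f // in_setX inE group1. Qed.

(** For [x] in H this is the class of (x, t). Translating the class of (1, t) makes it total in [x]
    and reduces its equivariance to [ind_hactM]. *)
Definition icl (x : G) (t : T) : ind_hset H T :=
  ind_hact x (exist _ (ind_class (1, t)) (ind_class1_subproof t)).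

Lemma val_icl x t : x \in H -> val (icl x t) = ind_class (x, t).
Proof. by move=> Hx; rewrite ind_hactE //= ind_translate_class mulg1. Qed.

Lemma icl_surj (z : ind_hset H T) : exists2 x, x \in H & exists t, z = icl x t.
Proof.
case/imsetP: (valP z) => -[x t] /setXP[Hx _] zE; exists x => //; exists t.
by apply: val_inj; rewrite val_icl.
Qed.

Lemma ind_hact_icl h x t : h \in H -> x \in H -> ind_hact h (icl x t) = icl (h * x) t.
Proof. by move=> Hh Hx; rewrite -ind_hactM. Qed.

Lemma icl_inj x y s t : x \in H -> y \in H -> icl x s = icl y t ->
  exists2 k, k \in K & x = y * k^-1 /\ s = hact k t.
Proof.
move=> Hx Hy /(congr1 val); rewrite !val_icl // => E.
have : (x, s) \in ind_class (y, t).
  by rewrite -E; apply/imsetP; exists 1; rewrite ?group1 //= invg1 mulg1 hact1.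
by case/imsetP => k Kk [-> ->]; exists k.
Qed.

Lemma icl_mulr x k t : K \subset H -> x \in H -> k \in K ->
  icl (x * k) t = icl x (hact k t).
Proof.
move=> sKH Hx Kk; have Hk := subsetP sKH k Kk.
apply: val_inj; rewrite !val_icl ?groupM //.
apply/setP => p; apply/imsetP/imsetP => -[j Kj ->] /=.
  exists (j * k^-1); rewrite ?groupM ?groupV //.
  by rewrite -hactM ?groupM ?groupV // mulgKV invMg invgK mulgA.
exists (j * k); rewrite ?groupM //.
by rewrite -hactM // invMg mulgA mulgK.
Qed.

Lemma icl_injr x : x \in H -> injective (icl x).
Proof.
move=> Hx s t /(icl_inj Hx Hx)[k _ [/(canLR (mulKg x))]].
by rewrite mulVg => /eqP; rewrite eq_sym eq_invg1 => /eqP -> ->; rewrite hact1.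
Qed.

End InducedClasses.
End Hsets.

Section Admissible.
Variables (G : finGroupType) (O : operad G).

(** Bijective labellings are expressed by multiplicities equal to 1, because multiplicities are
    invariant under [lequiv] and add up along [lmul]. *)
Definition mult (T : eqType) (t : T) (u : lop O T) : nat := lsum (fun s => s == t : nat) u.

Lemma sum_eq_bij (I T : finType) (f : I -> T) t : bijective f ->
  (\sum_i (f i == t : nat) = 1)%N.
Proof.
case=> g fK gK; rewrite (bigD1 (g t)) //= gK eqxx big1 ?addn0 // => i /eqP ni.
by case: eqP => // ft; case: ni; rewrite -ft fK.
Qed.

Lemma sum_eq_bijP (I T : finType) (f : I -> T) :
  (forall t, \sum_i (f i == t : nat) = 1)%N -> bijective f.
Proof.
move=> f1; have injf : injective f.
  move=> i j fij; apply/eqP/negPn/negP => nij; have := f1 (f i).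
  by rewrite (bigD1 i) //= (bigD1 j) 1?eq_sym //= fij eqxx.
have surf t : exists i, f i = t.
  case: (pselect (exists i, f i = t)) => // nft; have := f1 t.
  by rewrite big1 // => i _; case: eqP => // fit; case: nft; exists i.
apply: (Bijective (g := fun t => sval (cid (surf t)))) => [i|t]; last by case: cid.
by case: cid => j /= /injf.
Qed.

Lemma lsum_mult1 (T : finType) (u : lop O T) (w : T -> nat) :
  (forall t, mult t u = 1%N) -> lsum w u = (\sum_t w t)%N.
Proof.
move=> /sum_eq_bijP[g fK gK]; rewrite (reindex (lab u)) //.
by exists g => i _; rewrite ?fK ?gK.
Qed.

(** Being fixed by the graph means h x = x s, where s is the permutation by which h acts on the
    numbered set T; this is the equivalence of h u with u, for u the operation x labelled by the
    numbering. *)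
Lemma admissibleP (H : {group G}) (T : finHset H) :
  admissible O H T <-> exists u : lop O T, (forall t, mult t u = 1%N) /\
    {in H, forall h, lequiv (lmap h (hact h) u) u}.
Proof.
split=> [[x fixx]|[[n x e] /= [/sum_eq_bijP bije fixu]]].
  exists (Lop x enum_val); split=> [t|h Hh].
    exact/sum_eq_bij/enum_val_bij.
  have injs : injective (fun i : 'I_#|T| => enum_rank (hact h (enum_val i : T))).
    by move=> i j /enum_rank_inj/(hact_inj Hh)/enum_val_inj.
  have sE i : enum_val (perm injs i) = hact h (enum_val i : T) by rewrite permE enum_rankK.
  have /fixx : (h, perm injs) \in hgraph T.
    by rewrite inE /= Hh; apply/forallP => i; rewrite sE.
  rewrite /gsact /= => xE; apply/lequivP; exists (perm injs); split=> [|i].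
    by rewrite -[in RHS]xE -sactM mulgV sact1.
  by rewrite sE.
simpl in *; have nT : n = #|T| by rewrite -(card_ord n) (bij_eq_card bije).
move: x e bije fixu; rewrite {}nT => x e bije fixu {n}.
have injr : injective (fun i => enum_rank (e i)).
  by move=> i j /enum_rank_inj/(bij_inj bije).
pose r := perm injr; have rE i : enum_val (r i) = e i by rewrite permE enum_rankK.
(* Renumbering the inputs by [r] turns the labelling [e] into [enum_val]. *)
exists (sact x r^-1) => -[h s]; rewrite inE /= => /andP[Hh /forallP sE].
have /lequivP[t [xE eE]] := fixu h Hh.
have st : s = r^-1 * t * r.
  apply/permP => i; apply: enum_val_inj; rewrite (eqP (sE i)) !permM rE -eE.
  by rewrite -[lab _ _]rE permKV.
by rewrite /gsact /= gsactC xE -!sactM st !invMg invgK !mulgA mulgK mulgKV.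
Qed.

(** Plugging [c] into a fixed operation labelled by N gives an operation fixed by [lmul_fix], in
    which t occurs as often as in all the [c x] together. Subobjects, coproducts and induction
    reduce to this. *)
Lemma admissible_comp (H : {group G}) (N T : finHset H) (c : N -> lop O T) :
  admissible O H N ->
  {in H, forall h x, lequiv (lmap h (hact h) (c x)) (c (hact h x))} ->
  (forall t, \sum_x mult t (c x) = 1)%N -> admissible O H T.
Proof.
case/admissibleP => -[n x e] [u1 fixu] fixc c1; apply/admissibleP.
exists (lmul x (fun i => c (e i))); split=> [t|].
  by rewrite /mult lsum_lmul -(c1 t) -(lsum_mult1 _ u1).
apply: lmul_fix => h Hh; have /lequivP[s [xs es]] := fixu h Hh.
by exists s; split=> // i; rewrite -es; apply: fixc.
Qed.

Hypothesis Ofix : forall n, exists x : O n, forall g, gact g x = x.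

Lemma admissible_trivial (H : {group G}) (T : finHset H) :
  is_trivial_hset T -> admissible O H T.
Proof.
move=> trivT; apply/admissibleP; have [x fixx] := Ofix #|T|.
exists (Lop x enum_val); split=> [t|h Hh]; first exact/sum_eq_bij/enum_val_bij.
apply/lequivP; exists 1; split=> [|i]; first by rewrite sact1.
by rewrite perm1 trivT.
Qed.

(** Over the coset A with representative r, plug in r u, its labels t becoming the classes of (r,
    t). If r' represents h A, then h r = r' k with k in K, and k u is equivalent to u, whence
    equivariance. *)
Lemma admissible_ind (H K : {group G}) (T : finHset K) : K \subset H ->
  admissible O K T -> admissible O H (coset_hset H K) -> admissible O H (ind_hset H T).
Proof.
move=> sKH /admissibleP[u [u1 fixu]] admHK.
have rH (A : coset_hset H K) : repr (val A) \in H.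
  case/lcosetsP: (valP A) => x Hx ->.
  by have /lcosetP[k Kk ->] := mem_repr x (lcoset_refl K x);
     rewrite groupM // (subsetP sKH).
pose c (A : coset_hset H K) : lop O (ind_hset H T) :=
  lmap (repr (val A)) (icl H (T := T) (repr (val A))) u.
have cosetE (A : coset_hset H K) : val A = repr (val A) *: K.
  case/lcosetsP: (valP A) => x Hx ->.
  by apply/lcoset_eqP; rewrite lcoset_sym (mem_repr x) ?lcoset_refl.
apply: (admissible_comp (c := c)) => // [h Hh A|z].
  have AE : val (hact h A) = (h * repr (val A)) *: K.
    by rewrite coset_hactE // {1}cosetE lcosetM.
  have : repr (val (hact h A)) \in (h * repr (val A)) *: K.
    by rewrite AE (mem_repr (h * repr (val A))) ?lcoset_refl.
  case/lcosetP => k Kk rE.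
  have hrE : h * repr (val A) = repr (val (hact h A)) * k^-1 by rewrite rE mulgK.
  have Kk' : k^-1 \in K by rewrite groupV.
  rewrite /c lmap_comp hrE.
  rewrite (_ : lmap _ _ u = lmap (repr (val (hact h A)))
     (icl H (T := T) (repr (val (hact h A))))
     (lmap k^-1 (hact k^-1) u)); first exact/lequiv_lmap/fixu.
  rewrite lmap_comp; apply: eq_lmap => i.
  by rewrite [LHS]ind_hact_icl // hrE icl_mulr.
have [x Hx [t zE]] := icl_surj z.
have xP : x *: K \in lcosets K H by apply/lcosetsP; exists x.
(* The class of (x, t) labels an input over the coset x K only. *)
pose A0 : coset_hset H K := exist _ (x *: K) xP.
have : x \in repr (val A0) *: K by rewrite -cosetE /= lcoset_refl.
case/lcosetP => k Kk xE.
rewrite (bigD1 A0) //= big1 => [|A nA].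
  rewrite addn0 zE {1}xE icl_mulr // -[RHS](u1 (hact k t)) /mult /lsum /=.
  by apply: eq_bigr => i _; rewrite (inj_eq (icl_injr (rH A0))).
rewrite /mult /lsum /= big1 // => i _; case: eqP => // E.
case/negP: nA; rewrite -val_eqE /= cosetE.
have [j Kj [-> _]] := icl_inj (rH A) Hx (etrans E zE).
by apply/eqP/lcoset_eqP; rewrite mem_lcoset mulKg groupV.
Qed.

Lemma admissible_indexing_system : is_indexing_system (admissible O).
Proof.
split.
- exact: admissible_trivial.
- move=> H S T [f [bijf fh]] /admissibleP[u [u1 fixu]]; apply/admissibleP.
  exists (lmap 1 f u); split=> [t|h Hh].
    have [g fK gK] := bijf; rewrite -(u1 (g t)); apply: eq_bigr => i _ /=.
    by rewrite (can2_eq fK gK).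
  rewrite lmap_comp mulg1 (_ : lmap _ _ _ = lmap 1 f (lmap h (hact h) u)).
    exact/lequiv_lmap/fixu.
  by rewrite lmap_comp mul1g; apply: eq_lmap => i; rewrite fh.
- move=> H g T /admissibleP[u [u1 fixu]]; apply/admissibleP.
  (* For k in g H g^-1, k (g u) = g (k^g u), where k^g lies in H. *)
  exists (lmap g id u : lop O (conj_hset g T)); split=> [|k]; first exact: u1.
  rewrite mem_conjg invgK => Hk.
  rewrite lmap_comp (_ : lmap (k * g) _ u = lmap g id (lmap (k ^ g) (hact (k ^ g)) u)).
    exact/lequiv_lmap/fixu.
  by rewrite lmap_comp -conjgC.
- move=> H K sKH T /admissibleP[u [u1 fixu]]; apply/admissibleP.
  by exists u; split=> // h Kh; apply: fixu; apply: (subsetP sKH).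
- move=> H S T f injf fh admT.
  (* A G-fixed nullary operation, to be plugged in at the elements of T outside the image of [f]. *)
  have [z [z0 fixz]] : exists z : lop O S, (forall s, mult s z = 0%N) /\
      {in H, forall h, lequiv (lmap h (hact h) z) z}.
    have [x fixx] := Ofix 0; have b : 'I_0 -> S by case.
    exists (Lop x b); split=> [s|h _]; first by rewrite /mult /lsum /= big_ord0.
    apply/lequivP; exists 1; split=> [|[]//]; first by rewrite sact1.
  pose c t := if [pick s | f s == t] is Some s then lunit O s else z.
  have cE s : c (f s) = lunit O s.
    rewrite /c; case: pickP => [s' /eqP/injf -> //|/(_ s)]; by rewrite eqxx.
  have cN t : (forall s, f s <> t) -> c t = z.
    by rewrite /c; case: pickP => // s /eqP fst /(_ s).
  apply: (admissible_comp (c := c)) => // [h Hh t|s].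
    case: (pselect (exists s, f s = t)) => [[s <-]|nst].
      by rewrite -fh // !cE lmap_lunit; apply: lequiv_refl.
    rewrite !cN; [exact: fixz| |by move=> s fst; apply: nst; exists s].
    move=> s fst; apply: nst; exists (hact h^-1 s).
    by rewrite fh ?groupV // fst hactK.
  rewrite (bigD1 (f s)) //= cE /mult lsum_lunit eqxx big1 // => t nt.
  case: (pselect (exists s, f s = t)) => [[s' sE]|nst].
    by rewrite -sE cE lsum_lunit; case: eqP => // ss; rewrite -sE ss eqxx in nt.
  by rewrite cN; [apply: z0|move=> s' fst; apply: nst; exists s'].
- move=> H J T admT;
  (* The index set J with the trivial action of H. *)
  pose N := @FinHset _ H J (fun _ j => j) (fun _ => erefl) (fun _ _ _ _ _ => erefl).
  have uE j : exists u : lop O (T j), (forall t, mult t u = 1%N) /\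
      {in H, forall h, lequiv (lmap h (hact h) u) u} by apply/admissibleP.
  pose u j := sval (cid (uE j)).
  have uP j : (forall t, mult t (u j) = 1%N) /\
      {in H, forall h, lequiv (lmap h (hact h) (u j)) (u j)} by exact: svalP (cid (uE j)).
  pose c (j : N) : lop O (coprod_hset T) :=
    lmap 1 (fun t => Tagged (fun j => hset_car (T j)) t) (u j).
  apply: (admissible_comp (c := c)); first exact: admissible_trivial.
    move=> h Hh j; rewrite /c lmap_comp mulg1.
    rewrite (_ : lmap h _ (u j) = lmap 1 (fun t => Tagged (fun j => hset_car (T j)) t)
      (lmap h (hact h) (u j))); first exact/lequiv_lmap/(uP j).2.
    by rewrite lmap_comp mul1g.
  case=> j t; rewrite (bigD1 j) //= big1 => [|k nkj].
    rewrite addn0 -[RHS]((uP j).1 t); apply: eq_bigr => i _ /=.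
    by rewrite eq_Tagged.
  by rewrite /mult /lsum big1 // => i _; rewrite -tag_eqE /tag_eq /= (negbTE nkj).
- exact: admissible_ind.
Qed.

End Admissible.

(** * Fibrations of finite H-sets and induction on operads *)

Section Fibers.
Variables (G : finGroupType) (H : {group G}).

Section Stabilizer.
Variables (N : finHset H) (n : N).

Definition hstab : {set G} := [set h in H | hact h n == n].

Lemma hstab_group_set : group_set hstab.
Proof.
apply/group_setP; split=> [|h k]; first by rewrite inE group1 hact1 /=.
rewrite !inE => /andP[Hh /eqP hn] /andP[Hk /eqP kn].
by rewrite groupM // hactM // kn hn /=.
Qed.
Canonical hstab_group := Group hstab_group_set.

Lemma hstabP h : reflect (h \in H /\ hact h n = n) (h \in hstab).
Proof. by rewrite inE; apply: (iffP andP) => -[Hh /eqP]. Qed.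

Lemma hstab_sub : hstab \subset H.
Proof. by apply/subsetP => h /hstabP[]. Qed.
End Stabilizer.

Section Fiber.
Variables (T N : finHset H) (p : T -> N).
Hypothesis ph : is_hmap p.
Variable n : N.

Definition fib_car := {t : T | p t == n}.
(** For [h] in the stabilizer of [n] the default value is never taken. *)
Definition fib_hact (h : G) (t : fib_car) : fib_car := insubd t (hact h (val t)).

Lemma val_fib_hact h t : h \in hstab n -> val (fib_hact h t) = hact h (val t).
Proof.
move=> /hstabP[Hh hn]; rewrite val_insubd; case: ifP => //.
by rewrite ph // (eqP (valP t)) hn eqxx.
Qed.

Lemma fib_hact1 t : fib_hact 1 t = t.
Proof. by apply: val_inj; rewrite val_fib_hact ?group1 // hact1. Qed.

Lemma fib_hactM : {in hstab n &, forall h k t,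
  fib_hact (h * k) t = fib_hact h (fib_hact k t)}.
Proof.
move=> h k Hh Hk t; apply: val_inj; rewrite !val_fib_hact ?groupM //.
by case/hstabP: Hh Hk => Hh _ /hstabP[Hk _]; rewrite hactM.
Qed.

Definition fib_hset : finHset (hstab_group n) := FinHset fib_hact1 fib_hactM.
End Fiber.

(* T is a coproduct of sets H x_K F, over the fibers F of p at representatives
   of the orbits of N, with stabilizers K, and H/K is an orbit of N. *)
Lemma idx_fibers (L : hclass G) (T N : finHset H) (p : T -> N) (ph : is_hmap p) :
  is_indexing_system L -> L H N -> (forall n, L _ (fib_hset ph n)) -> L H T.
Proof.
move=> sL LN LF.
pose orb (n : N) := [set hact h n | h in H].
have orb_refl n : n \in orb n by apply/imsetP; exists 1; rewrite ?group1 ?hact1.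
have orbE h n : h \in H -> orb (hact h n) = orb n.
  move=> Hh; apply/setP => m; apply/imsetP/imsetP => -[k Hk ->].
    by exists (k * h); rewrite ?groupM // hactM.
  by exists (k * h^-1); rewrite ?groupM ?groupV // hactM ?groupV // hactK.
(* This depends on the orbit of [n] only, since the orbit is not empty and the default is never
   taken. *)
pose rep n := odflt n [pick m in orb n].
have rep_orb n : rep n \in orb n.
  by rewrite /rep; case: pickP => // /(_ n); rewrite orb_refl.
have repE h n : h \in H -> rep (hact h n) = rep n.
  move=> Hh; rewrite /rep orbE //.
  by case: pickP => // /(_ n); rewrite orb_refl.
have trE n : exists h, h \in H /\ hact h (rep n) = n.
  case/imsetP: (rep_orb n) => h Hh ->; exists h^-1.
  by rewrite groupV hactK.
pose tr n := sval (cid (trE n)).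
have [trH trK] : (forall n, tr n \in H) /\ (forall n, hact (tr n) (rep n) = n).
  by split=> n; case: (svalP (cid (trE n))).
have fibP t : p (hact (tr (p t))^-1 t) == rep (p t).
  by rewrite ph ?groupV // -{2}(trK (p t)) hactK.
(* Moving t by the inverse of [tr (p t)] brings it over the representative. *)
pose f0 t : fib_hset ph (rep (p t)) :=
  exist (fun t => is_true (p t == rep _)) _ (fibP t).
(* The coproduct of the [D n] runs over all of N, while [f] meets the representatives only: closure
   under subobjects then suffices. *)
pose D n := ind_hset H (fib_hset ph n).
pose emb n x a : coprod_hset D :=
  Tagged (fun n => hset_car (D n)) (icl H (T := fib_hset ph n) x a).
pose f (t : T) : coprod_hset D := emb _ (tr (p t)) (f0 t).
have LD : L H (coprod_hset D).
  apply: (idx_coprod sL) => n; apply: (idx_ind sL); rewrite ?hstab_sub //.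
  have cN (A : coset_hset H (hstab_group n)) :
      exists x, x \in H /\ val A = x *: hstab_group n.
    by case/lcosetsP: (valP A) => x Hx AE; exists x.
  (* The orbit map x K |-> x n embeds H/K into N, for K the stabilizer of n. *)
  pose e (A : coset_hset H (hstab_group n)) : N := hact (sval (cid (cN A))) n.
  have eE A x : x \in H -> val A = x *: hstab_group n -> e A = hact x n.
    move=> Hx AE; rewrite /e; case: cid => y [Hy yE] /=.
    have : y \in x *: hstab_group n by rewrite -AE yE lcoset_refl.
    by case/lcosetP => k /hstabP[Hk kn] ->; rewrite hactM // kn.
  apply: (idx_sub sL (f := e)) LN => [A B|h Hh A].
    have [[x [Hx xE]] [y [Hy yE]]] := (cN A, cN B).
    rewrite (eE _ x) // (eE _ y) // => xy; apply: val_inj; rewrite xE yE.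
    apply/lcoset_eqP; rewrite mem_lcoset; apply/hstabP.
    by rewrite groupM ?groupV // hactM ?groupV // xy hactK.
  have [x [Hx xE]] := cN A.
  rewrite (eE A x) // (eE (hact h A) (h * x)) ?groupM ?hactM //.
  by rewrite coset_hactE // xE lcosetM.
have emb_eq n m (a : fib_hset ph n) (b : fib_hset ph m) x y : x \in H -> y \in H ->
    n = m -> hact x (val a) = hact y (val b) -> emb n x a = emb m y b.
  move=> Hx Hy nm; case: m / nm b => b ab; congr (Tagged _ _).
  have Kk : y^-1 * x \in hstab_group n.
    apply/hstabP; rewrite !(groupM, groupV) //; split=> //.
    rewrite -{1}(eqP (valP a)) hactM ?groupV // -!ph ?groupV // ab hactK //.
    exact: (eqP (valP b)).
  rewrite -[x](mulKVg y) icl_mulr ?hstab_sub //; congr icl.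
  by apply: val_inj; rewrite val_fib_hact // hactM ?groupV // ab hactK.
have clE n (z : D n) : exists xa : G * fib_hset ph n, xa.1 \in H /\ z = icl H xa.1 xa.2.
  by have [x Hx [a ->]] := icl_surj z; exists (x, a).
(* A left inverse of [f]: the class of (x, a) goes to x a. *)
pose ret (z : coprod_hset D) : T :=
  let xa := sval (cid (clE (tag z) (tagged z))) in hact xa.1 (val xa.2).
have retE n x a : x \in H -> ret (emb n x a) = hact x (val a).
  move=> Hx; rewrite /ret /emb /=; case: cid => -[y b] /= [Hy E].
  have := @icl_inj _ H _ (fib_hset ph n) x y a b Hx Hy E.
  case=> k Kk [-> ->]; rewrite val_fib_hact //; have [Hk _] := hstabP _ _ Kk.
  by rewrite -hactM ?groupM ?groupV // mulgKV.
have fK : cancel f ret.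
  by move=> t; rewrite retE //= hactKV.
apply: (idx_sub sL (can_inj fK) _ LD) => h Hh t.
transitivity (emb _ (h * tr (p t)) (f0 t)); last first.
  by congr (Tagged _ _); rewrite /= ind_hact_icl.
apply: emb_eq; rewrite ?groupM //; first by rewrite ph // repE.
by rewrite /= hactM // !hactKV.
Qed.

End Fibers.

(** * Suboperads and induction from universal properties *)

Section Induction.
Variable G : finGroupType.

Lemma ophom_admissible (O P : operad G) (f : ophom O P) (H : {group G}) (T : finHset H) :
  admissible O H T -> admissible P H T.
Proof.
have [[fg fs] _ _] := ophomP f.
case=> x fixx; exists (f _ x) => p /fixx.
by rewrite /gsact -fg -fs => ->.
Qed.

Definition op_closed (C : operad G) (Phi : forall n, C n -> Prop) : Prop :=
  [/\ forall n g (x : C n), Phi n x -> Phi n (gact g x),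
      forall n (x : C n) s, Phi n x -> Phi n (sact x s),
      Phi 1%N (opid C) &
      forall n (k : 'I_n -> nat) (x : C n) (y : forall i, C (k i)),
        Phi n x -> (forall i, Phi (k i) (y i)) -> Phi _ (gam x y)].

Section Suboperad.
Variables (C : operad G) (Phi : forall n, C n -> Prop).
Hypothesis PhiP : op_closed Phi.

Definition sub_car n := {x : C n | Phi x}.
Definition sub_gact n g (x : sub_car n) : sub_car n :=
  exist _ (gact g (sval x)) (let: And4 h _ _ _ := PhiP in h n g _ (svalP x)).
Definition sub_sact n (x : sub_car n) s : sub_car n :=
  exist _ (sact (sval x) s) (let: And4 _ h _ _ := PhiP in h n _ s (svalP x)).
Definition sub_id : sub_car 1 := exist _ (opid C) (let: And4 _ _ h _ := PhiP in h).
Definition sub_gam n (k : 'I_n -> nat) (x : sub_car n) (y : forall i, sub_car (k i)) :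
    sub_car (\sum_(i < n) k i)%N :=
  exist _ (gam (sval x) (fun i => sval (y i)))
    (let: And4 _ _ _ h := PhiP in h n k _ _ (svalP x) (fun i => svalP (y i))).

Lemma sub_inj n (x y : sub_car n) : sval x = sval y -> x = y.
Proof. by case: x y => x xP [y yP] /= xy; apply: eq_exist. Qed.

Lemma sval_arcast m n (e : m = n) (x : sub_car m) :
  sval (arcast e x) = arcast e (sval x).
Proof. exact: (arcast_map (S := sub_car) (T := C) (fun n x => sval x)). Qed.

Program Definition sub_sym : symseq G :=
  {| sym_car := sub_car; gact := sub_gact; sact := sub_sact |}.
Next Obligation. by move=> n x; apply: sub_inj; rewrite /= gact1. Qed.
Next Obligation. by move=> n g h x; apply: sub_inj; rewrite /= gactM. Qed.
Next Obligation. by move=> n x; apply: sub_inj; rewrite /= sact1. Qed.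
Next Obligation. by move=> n x s t; apply: sub_inj; rewrite /= sactM. Qed.
Next Obligation. by move=> n g x s; apply: sub_inj; rewrite /= gsactC. Qed.

Program Definition sub_operad : operad G :=
  {| op_sym := sub_sym; opid := sub_id; gam := sub_gam |}.
Next Obligation. by move=> g; apply: sub_inj; rewrite /= gact_id. Qed.
Next Obligation. by move=> n k g x y; apply: sub_inj; rewrite /= gact_gam. Qed.
Next Obligation. by move=> m y; apply: sub_inj; rewrite sval_arcast /= gam_idl. Qed.
Next Obligation. by move=> n x; apply: sub_inj; rewrite sval_arcast /= gam_idr. Qed.
Next Obligation.
move=> n k l x y z; apply: sub_inj; rewrite sval_arcast /=.
exact: (gamA (l := l) (sval x) _ (fun i j => sval (z i j))).
Qed.
Next Obligation.
move=> n k x s y; apply: sub_inj; rewrite /= sval_arcast.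
exact: (gam_sactl (sval x) s (fun i => sval (y i))).
Qed.
Next Obligation.
by move=> n k x y t; apply: sub_inj; rewrite /= (gam_sactr (sval x)).
Qed.

Lemma sval_ophom : @is_ophom G sub_operad C (fun n x => sval x).
Proof. by []. Qed.
End Suboperad.

Lemma comp_ophomP (A B C : operad G) (g : ophom B C) (f : ophom A B) :
  is_ophom (fun n x => g n (f n x)).
Proof.
have [[[gg gs] g1 gm] [[fg fs] f1 fm]] := (ophomP g, ophomP f).
by split=> [|/=|n k x y /=]; rewrite ?f1 ?fm ?gm //; split=> *; rewrite ?fg ?fs ?gg ?gs.
Qed.
Definition comp_ophom (A B C : operad G) (g : ophom B C) (f : ophom A B) : ophom A C :=
  Ophom (comp_ophomP g f).

Lemma id_ophomP (A : operad G) : @is_ophom G A A (fun n x => x). Proof. by []. Qed.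
Definition id_ophom (A : operad G) : ophom A A := Ophom (@id_ophomP A).

(** The operations satisfying [Phi] form a suboperad through which [i] and [j] factor. The composite
    of the induced map from C to it with the inclusion is the identity, by uniqueness. *)
Lemma coproduct_ind (O P C : operad G) (i : ophom O C) (j : ophom P C)
    (Phi : forall n, C n -> Prop) : is_coproduct i j -> op_closed Phi ->
  (forall n x, Phi n (i n x)) -> (forall n y, Phi n (j n y)) -> forall n z, Phi n z.
Proof.
move=> cop PhiP Pi Pj n z; pose S := sub_operad PhiP.
have [[[ig is'] i1 im] [[jg js] j1 jm]] := (ophomP i, ophomP j).
have iP : @is_ophom G O S (fun n x => exist _ _ (Pi n x)).
  by split=> [||m k x y]; first split=> *; apply: sub_inj; rewrite /= ?ig ?is' ?i1 ?im.
have jP : @is_ophom G P S (fun n x => exist _ _ (Pj n x)).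
  by split=> [||m k x y]; first split=> *; apply: sub_inj; rewrite /= ?jg ?js ?j1 ?jm.
have [h [[hi hj] _]] := cop S (Ophom iP) (Ophom jP).
have [e [_ uniq_e]] := cop C i j.
have -> : z = sval (h n z); last exact: svalP (h n z).
rewrite -[LHS]/(id_ophom C n z) (uniq_e (id_ophom C)) //.
rewrite -(uniq_e (comp_ophom (Ophom (sval_ophom PhiP)) h)) //=.
by split=> m x; rewrite ?hi ?hj.
Qed.

(** The argument of [coproduct_ind], with the universal property of the free operad. *)
Lemma free_ind (S : symseq G) (F : operad G) (eta : symhom S F)
    (Phi : forall n, F n -> Prop) : is_free_on eta -> op_closed Phi ->
  (forall n x, Phi n (eta n x)) -> forall n z, Phi n z.
Proof.
move=> free PhiP Pe n z; pose F' := sub_operad PhiP.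
have [eg es] := symhomP eta.
have eP : @is_symhom G S F' (fun n x => exist _ _ (Pe n x)).
  by split=> *; apply: sub_inj; rewrite /= ?eg ?es.
have [h [he _]] := free F' (Symhom eP).
have [e [_ uniq_e]] := free F eta.
have -> : z = sval (h n z); last exact: svalP (h n z).
rewrite -[LHS]/(id_ophom F n z) (uniq_e (id_ophom F)) //.
rewrite -(uniq_e (comp_ophom (Ophom (sval_ophom PhiP)) h)) //=.
by move=> m x; rewrite he.
Qed.

End Induction.

(** * The endomorphism operad *)

Section EndomorphismOperad.
Variables (G : finGroupType) (A : Type) (ga : G -> A -> A).
Hypothesis ga1 : forall a, ga 1 a = a.
Hypothesis gaM : forall g h a, ga (g * h) a = ga g (ga h a).

Definition end_car n := ('I_n -> A) -> A.
Definition end_gact n g (f : end_car n) : end_car n :=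
  fun a => ga g (f (fun i => ga g^-1 (a i))).
(** The inverse ensures that (f s)(a o s) = f(a), in agreement with [lequiv]. *)
Definition end_sact n (f : end_car n) (s : 'S_n) : end_car n :=
  fun a => f (fun i => a (s^-1 i)).
Definition end_gam n (k : 'I_n -> nat) (f : end_car n) (y : forall i, end_car (k i)) :
    end_car (\sum_(i < n) k i)%N :=
  fun c => f (fun i => y i (fun j => c (rk i j))).

Lemma end_arcast m n (e : m = n) (f : end_car m) a :
  arcast e f a = f (fun i => a (cast_ord e i)).
Proof.
by case: n / e a => a /=; congr f; apply/funext => i; rewrite cast_ord_id.
Qed.

Program Definition end_sym : symseq G :=
  {| sym_car := end_car; gact := end_gact; sact := end_sact |}.
Next Obligation.
move=> n f; apply/funext => a; rewrite /end_gact ga1; congr f.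
by apply/funext => i; rewrite invg1 ga1.
Qed.
Next Obligation.
move=> n g h f; apply/funext => a; rewrite /end_gact gaM; congr (ga g (ga h (f _))).
by apply/funext => i; rewrite invMg gaM.
Qed.
Next Obligation.
move=> n f; apply/funext => a; congr f; apply/funext => i.
by rewrite invg1 perm1.
Qed.
Next Obligation.
move=> n f s t; apply/funext => a; congr f; apply/funext => i.
by rewrite invMg permM.
Qed.
Next Obligation. by []. Qed.

(** A morphism from O to this operad is an O-algebra structure on the G-set A. Hence actions of O
    and P on A combine into an action of their coproduct. *)
Program Definition end_operad : operad G :=
  {| op_sym := end_sym; opid := fun a => a ord0; gam := end_gam |}.
Next Obligation.
move=> g; apply/funext => a.
by rewrite /= /end_gact -gaM mulgV ga1.
Qed.
Next Obligation.
move=> n k g f y; apply/funext => a; congr (ga g (f _)); apply/funext => i.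
rewrite /= /end_gact -gaM mulVg ga1.
by congr (y i _).
Qed.
Next Obligation.
move=> m y; apply/funext => a; rewrite end_arcast; congr y; apply/funext => i.
rewrite sum_one_cast; congr a; apply: ord_inj.
by rewrite tagnat.Rank2K.
Qed.
Next Obligation.
move=> n x; apply/funext => a; rewrite end_arcast; congr x; apply/funext => i.
by rewrite sum_ones_cast tagnat.Rank1K.
Qed.
Next Obligation.
move=> n k l x y z; apply/funext => c; rewrite end_arcast.
congr x; apply/funext => i; congr (y i _); apply/funext => j.
rewrite -[RHS](rkK (fun i j => z i j (fun p => c (rk i (rk j p))))).
congr (z _ _ _); apply/funext => p; rewrite sum_sum_cast; congr c.
rewrite (rkK (k := fun b => l (rk1 b) (rk2 b))
  (fun b p => @rk _ (fun i => (\sum_(j < k i) l i j)%N)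
     (rk1 b) (@rk _ (l (rk1 b)) (rk2 b) p))).
by [].
Qed.
Next Obligation.
move=> n k x s y; apply/funext => c; rewrite /= /end_sact end_arcast.
congr x; apply/funext => i.
pose F i := y i (fun j => c ((block_perm k s)^-1 (cast_ord (sum_perm k s) (rk i j)))).
rewrite -[RHS]/(F i) -[i in RHS](permKV s) /F; move: (s^-1 i) => {}i.
congr (y (s i) _); apply/funext => j; congr c.
apply: (canRL (permK _)); rewrite permE /block_fun.
by rewrite (rkK (fun a b => cast_ord (sum_perm k s) (@rk _ k (s a) b))).
Qed.
Next Obligation.
move=> n k x y t; apply/funext => c; congr x; apply/funext => i.
congr (y i _); apply/funext => j; congr c.
apply: (canRL (permK _)); rewrite permE /dsum_fun.
by rewrite (rkK (fun a b => rk a (t a b))) permKV.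
Qed.
End EndomorphismOperad.

(** * Alternating trees *)

Section NormalForms.
Variables (G : finGroupType) (O : operad G) (Y : Type).

(** A representative of the class of [u]. It is chosen from the predicate of being equivalent to
    [u], which is the same for equivalent operations, so that the choice is the same too. *)
Definition lnf (u : lop O Y) : lop O Y :=
  sval (cid (ex_intro (fun v => lequiv v u) u (lequiv_refl u))).

Lemma lnf_equiv u : lequiv (lnf u) u. Proof. by rewrite /lnf; case: cid. Qed.

Lemma lnf_eq u v : lequiv u v -> lnf u = lnf v.
Proof.
move=> uv; rewrite /lnf.
have E : (fun w => lequiv w u) = (fun w => lequiv w v).
  apply/funext => w; apply/propext; split=> wu; first exact: lequiv_trans wu uv.
  exact: lequiv_trans wu (lequiv_sym uv).
move: (ex_intro _ u _) (ex_intro _ v _) => /=; rewrite E => p q.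
by rewrite (Prop_irrelevance p q).
Qed.

(** Whether an operation is the identity up to renumbering does not depend on its labels. *)
Lemma lequiv_relabel Z (u : lop O Y) y (f : 'I_(ar u) -> Z) :
  lequiv u (lunit O y) -> exists z, lequiv (Lop (opn u) f) (lunit O z).
Proof.
case=> s E; rewrite {}E /= in f *; exists (f ord0), s.
by apply: Lop_ext => // i; rewrite [i]ord1.
Qed.
End NormalForms.

Section Trees.
Variables (G : finGroupType) (Op : bool -> operad G) (X : Type).

Inductive tree :=
| Leaf of X
| Node (c : bool) n (x : Op c n) (k : 'I_n -> tree).

Implicit Types (t : tree) (c : bool).

(** Suppressing identities and choosing representatives makes the result depend on the class of [u]
    only. *)
Definition tmk c (u : lop (Op c) tree) : tree :=
  match pselect (exists t, lequiv u (lunit _ t)) with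
  | left p => sval (cid p)
  | right _ => Node (opn (lnf u)) (lab (lnf u))
  end.

(** On well-formed trees this is inverse to [tmk] up to [lequiv]: they form the free [Op c]-algebra
    on those whose root does not have colour [c]. *)
Definition tview c t : lop (Op c) tree :=
  match t with
  | Leaf _ => lunit _ t
  | Node d n x k =>
    match d =P c with
    | ReflectT e => eq_rect d (fun c => lop (Op c) tree) (Lop x k) c e
    | ReflectF _ => lunit _ t
    end
  end.

Definition thead c t : bool := if t is Node d _ _ _ then d == c else false.

(* Alternating trees whose vertices are the chosen representatives, none of
   them equivalent to the identity. *)
Fixpoint twf t : Prop :=
  match t with
  | Leaf _ => True
  | Node c n x k =>
    [/\ lnf (Lop x k) = Lop x k,
        ~ (exists t, lequiv (Lop x k) (lunit _ t)) &
        forall i, twf (k i) /\ ~~ thead c (k i)]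
  end.

Definition lwf c (u : lop (Op c) tree) : Prop :=
  forall i, twf (lab u i) /\ ~~ thead c (lab u i).

Lemma lwf_lequiv c (u v : lop (Op c) tree) : lequiv u v -> lwf v -> lwf u.
Proof. by move=> uv wfv i; have [j ->] := lequiv_lab i uv. Qed.

Lemma lwf_lmul c n (x : Op c n) (u : 'I_n -> lop (Op c) tree) :
  (forall i, lwf (u i)) -> lwf (lmul x u).
Proof. by move=> wfu a; apply: wfu. Qed.

Lemma tmk_unit c (u : lop (Op c) tree) t : lequiv u (lunit _ t) -> tmk u = t.
Proof.
move=> ut; rewrite /tmk; case: pselect => [p|[]]; last by exists t.
by case: cid => t' /= ut'; apply/lequiv_lunit/(lequiv_trans (lequiv_sym ut') ut).
Qed.

Lemma tmk_node c (u : lop (Op c) tree) : ~ (exists t, lequiv u (lunit _ t)) ->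
  tmk u = Node (opn (lnf u)) (lab (lnf u)).
Proof. by rewrite /tmk; case: pselect. Qed.

Lemma tmk_eq c (u v : lop (Op c) tree) : lequiv u v -> tmk u = tmk v.
Proof.
move=> uv; case: (pselect (exists t, lequiv v (lunit _ t))) => [[t vt]|nv].
  by rewrite (tmk_unit vt) (tmk_unit (lequiv_trans uv vt)).
rewrite !tmk_node //; first by rewrite (lnf_eq uv).
by move=> [t ut]; apply: nv; exists t; apply: lequiv_trans (lequiv_sym uv) ut.
Qed.

Lemma tview_node c n (x : Op c n) k : tview c (Node x k) = Lop x k.
Proof. by rewrite /=; case: eqP => // e; rewrite (eq_irrelevance e erefl). Qed.

Lemma tview_unit c t : ~~ thead c t -> tview c t = lunit _ t.
Proof. by case: t => //= d n x k; case: eqP. Qed.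

Lemma lwf_tview c t : twf t -> lwf (tview c t).
Proof.
move=> wft; case hd: (thead c t); last by rewrite tview_unit ?hd // => i; rewrite hd.
case: t wft hd => //= d n x k [_ _ wfk] /eqP dc.
by case: c / dc; rewrite -/(tview d (Node x k)) tview_node.
Qed.

Lemma twf_tmk c (u : lop (Op c) tree) : lwf u -> twf (tmk u).
Proof.
move=> wfu; case: (pselect (exists t, lequiv u (lunit _ t))) => [[t ut]|nu].
  rewrite (tmk_unit ut).
  by have [i /= ->] := lequiv_lab (ord0 : 'I_(ar (lunit (Op c) t))) (lequiv_sym ut);
     case: (wfu i).
rewrite tmk_node //= lopE; have nfu := lnf_equiv u.
split; first exact: lnf_eq.
  by move=> [t ut]; apply: nu; exists t; apply: lequiv_trans (lequiv_sym nfu) ut.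
exact: lwf_lequiv nfu wfu.
Qed.

Lemma tmk_view c t : twf t -> tmk (tview c t) = t.
Proof.
move=> wft; case hd: (thead c t); last first.
  by rewrite tview_unit ?hd //; apply: tmk_unit; apply: lequiv_refl.
case: t wft hd => //= d n x k [nfk nk _] /eqP dc.
case: c / dc; rewrite -/(tview d (Node x k)) tview_node tmk_node //.
by rewrite nfk.
Qed.

Lemma tview_mk c (u : lop (Op c) tree) : lwf u -> lequiv (tview c (tmk u)) u.
Proof.
move=> wfu; case: (pselect (exists t, lequiv u (lunit _ t))) => [[t ut]|nu].
  rewrite (tmk_unit ut) tview_unit; first exact: lequiv_sym.
  by have [i /= ->] := lequiv_lab (ord0 : 'I_(ar (lunit (Op c) t))) (lequiv_sym ut);
     case: (wfu i).
by rewrite tmk_node // tview_node lopE; apply: lnf_equiv.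
Qed.

(** The multiplication of the free [Op c]-algebra, transported along [tview]: [x] merges with the
    roots of its own colour. *)
Definition tact c n (x : Op c n) (a : 'I_n -> tree) : tree :=
  tmk (lmul x (fun i => tview c (a i))).

Lemma twf_tact c n (x : Op c n) a : (forall i, twf (a i)) -> twf (tact x a).
Proof. by move=> wfa; apply/twf_tmk/lwf_lmul => i; apply: lwf_tview. Qed.

Lemma tview_tact c n (x : Op c n) a : (forall i, twf (a i)) ->
  lequiv (tview c (tact x a)) (lmul x (fun i => tview c (a i))).
Proof. by move=> wfa; apply/tview_mk/lwf_lmul => i; apply: lwf_tview. Qed.

Lemma tact_id c t : twf t -> tact (opid (Op c)) (fun=> t) = t.
Proof. by move=> wft; rewrite /tact lmul_idl tmk_view. Qed.

Lemma tact_sact c n (x : Op c n) s a :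
  tact (sact x s) (fun i => a (s i)) = tact x a.
Proof. exact/tmk_eq/(lmul_sactl x s (fun i => tview c (a i))). Qed.

Lemma tact_gam c n (k : 'I_n -> nat) (x : Op c n) (y : forall i, Op c (k i))
    (a : forall i, 'I_(k i) -> tree) : (forall i j, twf (a i j)) ->
  tact (gam x y) (fun b => a (rk1 b) (rk2 b)) = tact x (fun i => tact (y i) (a i)).
Proof.
move=> wfa; rewrite /tact (lmulA x y (fun i j => tview c (a i j))).
by apply/tmk_eq/lmul_ext => i; apply/lequiv_sym/tview_tact.
Qed.

(** The vertices are rebuilt by [tmk] since [g] and [tau] may not preserve the chosen
    representatives. *)
Fixpoint tmap g (tau : X -> X) t : tree :=
  match t with
  | Leaf x => Leaf (tau x)
  | Node c n x k => tmk (Lop (gact g x) (fun i => tmap g tau (k i)))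
  end.

Lemma tmap_mk g tau c (u : lop (Op c) tree) :
  tmap g tau (tmk u) = tmk (lmap g (tmap g tau) u).
Proof.
case: (pselect (exists t, lequiv u (lunit _ t))) => [[t ut]|nu].
  rewrite (tmk_unit ut); apply/esym/tmk_unit.
  by rewrite -(lmap_lunit (Op c) g (tmap g tau)); apply: lequiv_lmap.
by rewrite tmk_node //=; apply/tmk_eq/(lequiv_lmap g (tmap g tau))/lnf_equiv.
Qed.

Lemma tmap_comp g h tau sigma t :
  tmap g tau (tmap h sigma t) = tmap (g * h) (fun x => tau (sigma x)) t.
Proof.
elim: t => //= c n x k IH; rewrite tmap_mk; congr tmk.
by apply: Lop_ext => //=; rewrite gactM.
Qed.

Lemma tmap_id t : twf t -> tmap 1 id t = t.
Proof.
elim: t => //= c n x k IH [nfk nk wfk].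
rewrite gact1 (_ : (fun i => _) = k) ?tmk_node ?nfk //.
by apply/funext => i; apply: IH; case: (wfk i).
Qed.

Lemma twf_tmap g tau t : twf t ->
  twf (tmap g tau t) /\ forall c, thead c (tmap g tau t) = thead c t.
Proof.
elim: t => //= c n x k IH [nfk nk wfk].
set u := Lop _ _.
(* If g x were the identity up to renumbering, acting by g^-1 would show the same of x. *)
have nu : ~ exists t, lequiv u (lunit _ t).
  case=> t ut; apply: nk.
  have [z uz] := @lequiv_relabel _ _ _ _ u _ k ut; exists z; move/(lequiv_lmap g^-1 id): uz.
  by rewrite lmap_lunit /lmap /= -gactM mulVg gact1.
have wfu : lwf u.
  move=> i; have [wfi hi] := wfk i; have [wf' hd] := IH i wfi.
  by rewrite /= hd.
split; first exact: twf_tmk.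
by move=> d; rewrite tmk_node.
Qed.

Lemma tview_tmap g tau c t : twf t ->
  lequiv (tview c (tmap g tau t)) (lmap g (tmap g tau) (tview c t)).
Proof.
move=> wft; have [wf' hd] := twf_tmap g tau wft.
rewrite -{1}(tmk_view c wft) tmap_mk; apply: tview_mk => i /=.
have [wfi hi] := lwf_tview (c := c) wft i.
by have [wf'' hd'] := twf_tmap g tau wfi; rewrite hd'.
Qed.

Lemma tmap_tact g tau c n (x : Op c n) a : (forall i, twf (a i)) ->
  tmap g tau (tact x a) = tact (gact g x) (fun i => tmap g tau (a i)).
Proof.
move=> wfa; rewrite /tact tmap_mk lmap_lmul.
by apply/tmk_eq/lmul_ext => i; apply/lequiv_sym/tview_tmap.
Qed.

End Trees.

(** * Symmetries of an operation of a Sigma-free operad *)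

Section SigmaFree.
Variables (G : finGroupType) (O : operad G).

Definition sigma_free := forall n (x : O n) (s : 'S_n), sact x s = x -> s = 1.

Hypothesis freeO : sigma_free.

Lemma sact_inj n (x : O n) s t : sact x s = sact x t -> s = t.
Proof.
move=> E; apply/eqP; rewrite eq_sym eq_mulVg1; apply/eqP/(freeO (x := x)).
by rewrite sactM E -sactM mulVg sact1.
Qed.

Section SymmetryAction.
Variables (K : {group G}) (n : nat) (x : O n).
Hypothesis xK : forall h, exists s : 'S_n, h \in K -> gact h x = sact x s.

(** For h in K the permutation s with h x = x s is unique by freeness, which makes K act on the
    inputs of x. Outside K the choice is arbitrary. *)
Definition sym_hact (h : G) : 'I_n -> 'I_n := sval (cid (xK h)).

Lemma sym_hactP h : h \in K -> exists2 s : 'S_n, gact h x = sact x s & sym_hact h = s.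
Proof. by rewrite /sym_hact; case: cid => s /= sP /sP; exists s. Qed.

Lemma sym_hactE h (s : 'S_n) : h \in K -> gact h x = sact x s -> sym_hact h =1 s.
Proof. by move=> /sym_hactP[t -> ->] /sact_inj ->. Qed.

Lemma sym_hact1 i : sym_hact 1 i = i.
Proof. by rewrite (sym_hactE (s := 1)) ?perm1 // gact1 sact1. Qed.

Lemma sym_hactM : {in K &, forall h k i, sym_hact (h * k) i = sym_hact h (sym_hact k i)}.
Proof.
move=> h k Hh Hk i; have [s hs ->] := sym_hactP Hh; have [t kt ->] := sym_hactP Hk.
rewrite (sym_hactE (s := t * s)) ?groupM ?permM //.
by rewrite gactM kt gsactC hs sactM.
Qed.

Definition sym_hset : finHset K := @FinHset _ K 'I_n sym_hact sym_hact1 sym_hactM.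

(** The witness is [x], each input being its own label. *)
Lemma admissible_sym : admissible O K sym_hset.
Proof.
apply/admissibleP; exists (@Lop _ O sym_hset n x id); split=> [t|h Hh].
  by apply: (@sum_eq_bij 'I_n 'I_n); exists id.
have [s hs sE] := sym_hactP Hh.
by apply/lequivP; exists s; split=> // i; rewrite -sE.
Qed.
End SymmetryAction.
End SigmaFree.

(** * The algebra of alternating trees and its fixed points *)

Section TreeAlgebra.
Variables (G : finGroupType) (Op : bool -> operad G) (X : finHset [set: G]).
Local Notation tree := (tree Op X).

Fixpoint tmult (y : X) (t : tree) : nat :=
  match t with
  | Leaf x => x == y
  | Node c n x k => (\sum_(i < n) tmult y (k i))%N
  end.

Lemma tmult_mk y c (u : lop (Op c) tree) : tmult y (tmk u) = lsum (tmult y) u.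
Proof.
case: (pselect (exists t, lequiv u (lunit _ t))) => [[t ut]|nu].
  by rewrite (tmk_unit ut) (lsum_lequiv _ ut) lsum_lunit.
by rewrite tmk_node //= -[LHS]/(lsum _ (lnf u)); apply/lsum_lequiv/lnf_equiv.
Qed.

Lemma lsum_tview y c t : twf t -> lsum (tmult y) (tview c t) = tmult y t.
Proof. by move=> wft; rewrite -tmult_mk tmk_view. Qed.

Lemma tmult_tact y c n (x : Op c n) a : (forall i, twf (a i)) ->
  tmult y (tact x a) = (\sum_(i < n) tmult y (a i))%N.
Proof.
move=> wfa; rewrite tmult_mk lsum_lmul.
by apply: eq_bigr => i _; apply: lsum_tview.
Qed.

Lemma tmult_tmap y g tau t : injective tau -> tmult (tau y) (tmap g tau t) = tmult y t.
Proof.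
move=> inj_tau; elim: t => /= [x|c n x k IH]; first by rewrite (inj_eq inj_tau).
by rewrite tmult_mk; apply: eq_bigr => i _; apply: IH.
Qed.

(** At the root the equation reads x = x s, so s = 1 by freeness and [tau] fixes every subtree; then
    induct on the subtree containing y. *)
Lemma tmap_fix_leaves (freeOp : forall c, sigma_free (Op c)) tau t y :
  twf t -> tmap 1 tau t = t -> (0 < tmult y t)%N -> tau y = y.
Proof.
elim: t => [x|c n x k IH].
  by rewrite /= => _ [E]; case: eqP => // <-.
move=> wft.
move=> E; have := tview_tmap 1 tau c wft; rewrite E tview_node.
case/lequivP => s [E1 E2].
have s1 : s = 1 by apply: (freeOp c n x); rewrite gact1 in E1; rewrite -E1.
rewrite lt0n sum_nat_eq0 => /forallPn[i]; rewrite negb_imply -lt0n.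
apply: IH; first by case: wft => _ _ /(_ i)[].
by rewrite [RHS]E2 s1 perm1.
Qed.

Definition talg := {t : tree | twf t}.

Lemma talg_inj (s t : talg) : sval s = sval t -> s = t.
Proof. by case: s t => s sP [t tP] /= st; apply: eq_exist. Qed.

Definition talg_map g tau (t : talg) : talg :=
  exist _ (tmap g tau (sval t)) (twf_tmap g tau (svalP t)).1.
Definition talg_gact g : talg -> talg := talg_map g (hact g).
Definition talg_leaf (x : X) : talg := exist _ (Leaf Op x) I.

Lemma talg_gact1 t : talg_gact 1 t = t.
Proof.
apply: talg_inj; rewrite /= (_ : hact 1 = id) ?tmap_id //; first exact: svalP t.
by apply/funext => x; rewrite hact1.
Qed.

Lemma talg_gactM g h t : talg_gact (g * h) t = talg_gact g (talg_gact h t).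
Proof.
apply: talg_inj; rewrite /= tmap_comp; congr tmap.
by apply/funext => x; rewrite hactM ?inE.
Qed.

Definition talg_end : operad G := end_operad talg_gact1 talg_gactM.

Definition talg_op c n (x : Op c n) : talg_end n :=
  fun a => exist _ (tact x (fun i => sval (a i))) (twf_tact x (fun i => svalP (a i))).

Lemma talg_op_ophom c : @is_ophom G (Op c) talg_end (@talg_op c).
Proof.
split=> [||n k x y]; first split=> [n g x|n x s].
- apply/funext => a; apply: talg_inj; rewrite /= tmap_tact; last first.
    by move=> i; apply: svalP (talg_gact g^-1 (a i)).
  congr tact; apply/funext => i.
  by rewrite -[RHS]/(sval (talg_gact g (talg_gact g^-1 (a i))))
     -talg_gactM mulgV talg_gact1.
- apply/funext => a; apply: talg_inj => /=.
  rewrite -(tact_sact x s); congr tact; apply/funext => i.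
  by rewrite permK.
- apply/funext => a; apply: talg_inj; rewrite /= -[RHS](tact_id c); last exact: svalP (a ord0).
  by congr tact; apply/funext => i; rewrite [i]ord1.
apply/funext => c'; apply: talg_inj => /=.
rewrite -(tact_gam (k := k) x y (fun i j => svalP (c' (rk i j)))) /=.
congr tact; apply/funext => b.
by rewrite /= tagnat.sig2K.
Qed.

Definition talg_hom c : ophom (Op c) talg_end := Ophom (@talg_op_ophom c).

(* T is identified by f with the leaves of t. *)
Lemma tree_indexing (L : hclass G) : is_indexing_system L ->
  (forall c, sigma_free (Op c)) -> (forall c, hclass_sub (admissible (Op c)) L) ->
  forall t, twf t -> forall (K : {group G}) (T : finHset K) (f : T -> X),
    injective f -> {in K, forall h x, f (hact h x) = hact h (f x)} ->
    {in K, forall h, tmap h (hact h) t = t} ->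
    (forall y, tmult y t = (y \in codom f)) -> L K T.
Proof.
move=> sL freeOp LOp; elim=> [x _ K T f injf fK _ multt
  |c n x k IH wft K T f injf fK fixt multt].
  apply: (idx_trivial sL) => h Hh a; apply: injf.
  have fx b : f b = x by have := multt (f b); rewrite codom_f /=; case: eqP.
  by rewrite !fx.
(* Compare the roots of the tree and of its image under h. *)
have uK h : h \in K -> exists s : 'S_n, gact h x = sact x s /\
    forall i, tmap h (hact h) (k i) = k (s i).
  move=> Hh; have := tview_tmap h (hact h) c wft; rewrite fixt // tview_node.
  by move/lequiv_sym/lequivP.
have xK h : exists s : 'S_n, h \in K -> gact h x = sact x s.
  case Hh: (h \in K); last by exists 1.
  by have [s [xs _]] := uK h Hh; exists s.
pose N := sym_hset (freeOp c) xK.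
have kN h i : h \in K -> tmap h (hact h) (k i) = k (hact (f := N) h i).
  move=> Hh; have [s [xs ks]] := uK h Hh.
  by rewrite ks; congr k; rewrite /= (sym_hactE (freeOp c) xK Hh xs).
have pE a : exists i, (0 < tmult (f a) (k i))%N.
  have := multt (f a); rewrite codom_f /= => E.
  case: (pselect (exists i, 0 < tmult (f a) (k i))%N) => // nE.
  move: E; rewrite big1 // => i _; apply/eqP; rewrite -leqn0 leqNgt.
  by apply/negP => ?; apply: nE; exists i.
(* The input of the root above which the leaf [f a] lies. *)
pose p (a : T) : N := sval (cid (pE a)).
have pP a : (0 < tmult (f a) (k (p a)))%N by rewrite /p; case: cid.
(* All multiplicities are at most 1, so no leaf lies in two subtrees. *)
have le1 y i j : i != j -> (0 < tmult y (k i))%N -> (0 < tmult y (k j))%N -> False.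
  move=> nij yi yj; have := multt y; rewrite /= (bigD1 i) //= (bigD1 j) 1?eq_sym //=.
  rewrite addnA => E; have : (1 + 1 <= (y \in codom f : nat))%N.
    by rewrite -E; apply: leq_trans (leq_add yi yj) (leq_addr _ _).
  by case: (y \in _).
have p_uniq a i : (0 < tmult (f a) (k i))%N -> p a = i.
  by move=> ai; apply/eqP/negPn/negP => nij; apply: (le1 _ _ _ nij (pP a) ai).
have ph : is_hmap p.
  move=> h Hh a; apply: p_uniq.
  by rewrite -kN // fK // tmult_tmap ?pP //; apply: hact_inj; rewrite inE.
apply: (@idx_fibers _ _ L T N p ph sL).
  exact/LOp/admissible_sym.
(* The fiber over i is the set of leaves of the subtree at i, which the stabilizer of i fixes. *)
move=> i; apply: (IH i _ (hstab_group i) (fib_hset ph i) (fun a => f (val a))).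
- by case: wft => _ _ /(_ i)[].
- by move=> a b /injf/val_inj.
- move=> h Hh a; rewrite val_fib_hact // fK //.
  by case/hstabP: Hh.
- by move=> h /hstabP[Hh hi]; rewrite kN // hi.
move=> y; have [y0|yi] := posnP (tmult y (k i)).
  rewrite y0; apply/esym/eqP; rewrite eqb0; apply/codomP => -[a ya].
  by have := pP (val a); rewrite (eqP (valP a)) -ya y0.
have := multt y; rewrite /= (bigD1 i) //=.
case: codomP => [[a ya]|_]; last by case: (tmult y (k i)) yi.
have pa : p a == i by apply/eqP/p_uniq; rewrite -ya.
rewrite (_ : y \in codom _) => [|].
  by case: (tmult y (k i)) yi => // -[].
by apply/codomP; exists (exist _ a pa).
Qed.

End TreeAlgebra.

(** * Coproducts *)

Definition opfam (G : finGroupType) (O P : operad G) (c : bool) : operad G :=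
  if c then O else P.

Section Coproduct.
Variables (G : finGroupType) (O P C : operad G) (i : ophom O C) (j : ophom P C).
Hypothesis cop : is_coproduct i j.
Local Notation Op := (opfam O P).

Section Evaluation.
Variable X : finHset [set: G].
Local Notation E := (talg_end Op X).

Lemma setT_hact_inj g : injective (hact (f := X) g).
Proof. by apply: hact_inj; rewrite inE. Qed.

Lemma setT_hactKV g : cancel (hact (f := X) g^-1) (hact g).
Proof. by apply: hactKV; rewrite inE. Qed.

(** Trees are an algebra over O and over P, hence over C. Both properties hold for the actions of O
    and P and pass to C by [coproduct_ind]: leaves are neither lost nor repeated, and evaluation
    commutes with equivariant relabelling. *)
Lemma tree_evaluation : exists ev : ophom C E,
  (forall n (z : C n) a y,
     tmult y (sval (ev n z a)) = \sum_(i < n) tmult y (sval (a i)))%N /\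
  (forall tau : X -> X, (forall g x, tau (hact g x) = hact g (tau x)) ->
     forall n (z : C n) a,
       ev n z (fun i => talg_map 1 tau (a i)) = talg_map 1 tau (ev n z a)).
Proof.
have [ev [[evi evj] _]] := cop (talg_hom Op X true) (talg_hom Op X false).
have [[evg evs] ev1 evm] := ophomP ev.
exists ev; split=> [n z|tau tauX n z].
  apply: (coproduct_ind (Phi := fun n z => forall a y,
     tmult y (sval (ev n z a)) = \sum_(i < n) tmult y (sval (a i)))%N cop) => {n z}.
  - split=> [n g x IH a y|n x s IH a y|a y|n k x y IHx IHy c z].
    + rewrite evg /= -{1}(setT_hactKV g y) tmult_tmap ?IH; last exact: setT_hact_inj.
      by apply: eq_bigr => b _; rewrite tmult_tmap //; exact: setT_hact_inj.
    + rewrite evs /= IH (reindex_inj (@perm_inj _ s)).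
      by apply: eq_bigr => b _; rewrite permK.
    + by rewrite ev1 /= big_ord1.
    rewrite evm /= IHx sum_rk; apply: eq_bigr => b _.
    by rewrite IHy.
  - move=> n x a y; rewrite evi /= (tmult_tact _ (c := true)) // => b.
    by apply: svalP (a b).
  move=> n x a y; rewrite evj /= (tmult_tact _ (c := false)) // => b.
  by apply: svalP (a b).
have mapC g t : talg_map 1 tau (talg_gact g t) = talg_gact g (talg_map 1 tau t).
  apply: talg_inj; rewrite /= !tmap_comp mul1g mulg1; congr tmap.
  by apply/funext => x; rewrite tauX.
apply: (coproduct_ind (Phi := fun n z => forall a,
  ev n z (fun i => talg_map 1 tau (a i)) = talg_map 1 tau (ev n z a)) cop) => {n z}.
- split=> [n g x IH a|n x s IH a|a|n k x y IHx IHy c].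
  + rewrite !evg /= /end_gact mapC -IH; congr (talg_gact g (ev n x _)).
    by apply/funext => b; rewrite mapC.
  + by rewrite !evs /= /end_sact -IH.
  + by rewrite ev1.
  rewrite evm /= /end_gam -IHx; congr (ev n x _); apply/funext => b.
  by rewrite -IHy.
- move=> n x a; rewrite evi; apply: talg_inj => /=.
  rewrite tmap_tact ?gact1 // => b; exact: svalP (a b).
move=> n x a; rewrite evj; apply: talg_inj => /=.
rewrite tmap_tact ?gact1 // => b; exact: svalP (a b).
Qed.
End Evaluation.

Hypotheses (freeO : sigma_free O) (freeP : sigma_free P).

Lemma free_opfam c : sigma_free (Op c). Proof. by case: c. Qed.

(** Evaluate z at n distinct leaves, with G acting trivially on them so that every relabelling is
    equivariant. If z s = z, then s^-1 fixes the resulting tree, hence its leaves. *)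
Lemma coproduct_sigma_free : sigma_free C.
Proof.
move=> n z s zs.
pose X := @FinHset _ [set: G] 'I_n (fun _ x => x) (fun _ => erefl) (fun _ _ _ _ _ => erefl).
have [ev [ev_mult ev_map]] := tree_evaluation X.
have [[_ evs] _ _] := ophomP ev.
pose a (b : 'I_n) : talg Op X := talg_leaf Op (b : X).
have fixz : tmap 1 (s^-1 : X -> X) (sval (ev n z a)) = sval (ev n z a).
  rewrite -{2}zs evs /= /end_sact.
  rewrite -[LHS]/(sval (talg_map 1 (s^-1 : X -> X) (ev n z a))) -ev_map //.
  by congr (sval (ev n z _)); apply/funext => b; apply: talg_inj.
apply/eqP; rewrite -eq_invg1; apply/eqP/permP => y; rewrite perm1.
apply: (tmap_fix_leaves free_opfam (svalP (ev n z a)) fixz (y := (y : X))).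
by rewrite ev_mult (bigD1 y) //= eqxx.
Qed.

Lemma coproduct_admissible (L : hclass G) : is_indexing_system L ->
  hclass_sub (admissible O) L -> hclass_sub (admissible P) L ->
  hclass_sub (admissible C) L.
Proof.
move=> sL LO LP H T /admissibleP[[n z e] [/sum_eq_bijP bije fixz]].
(* Leaves are labelled by a G-set, whereas T is an H-set; T embeds H-equivariantly in the induced
   G-set. *)
pose X := ind_hset [set: G] T.
pose f : T -> X := icl [set: G] 1.
have injf : injective f by apply: icl_injr; rewrite inE.
have fH : {in H, forall h x, f (hact h x) = hact h (f x)}.
  move=> h Hh x; rewrite /f /= ind_hact_icl ?inE // mulg1 -[h in RHS]mul1g icl_mulr ?inE //.
  exact: subsetT.
have [ev [ev_mult _]] := tree_evaluation X.
have [[evg evs] _ _] := ophomP ev.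
pose a (b : 'I_n) : talg Op X := talg_leaf Op (f (e b)).
apply: (@tree_indexing G Op X L sL free_opfam _ _ (svalP (ev n z a)) H T f) => //.
- by case.
- move=> h Hh; have /lequivP[s [zs es]] := fixz h Hh.
  rewrite -[LHS]/(sval (talg_gact h (ev n z a))); congr sval.
  transitivity (ev n (gact h z) (fun b => talg_gact h (a b))).
    rewrite evg /= /end_gact; congr (talg_gact h (ev n z _)).
    by apply/funext => b; rewrite -talg_gactM mulVg talg_gact1.
  rewrite zs evs /= /end_sact; congr (ev n z _); apply/funext => b.
  apply: talg_inj; congr (Leaf _ _).
  by rewrite -[LHS]fH // [hact _ _]es permKV.
move=> y; rewrite ev_mult /=.
case: codomP => [[x ->]|ny].
  rewrite -[RHS](sum_eq_bij x bije); apply: eq_bigr => b _.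
  by rewrite (inj_eq injf).
by rewrite big1 // => b _; case: eqP => // fe; case: ny; exists (e b).
Qed.
End Coproduct.

(** * Words of edges *)

Section Words.
Variables (G : finGroupType) (S : bool -> symseq G).

(** Letters are sets of pairs, so that equality of the classes [input x i] is plain equality. *)
Definition letter c := {n & (S c n * 'I_n)%type} -> Prop.

(* The class of the pair (x, i) in S(n) x_{Sigma_n} {0, ..., n-1}. *)
Definition input c n (x : S c n) (i : 'I_n) : letter c :=
  fun p => exists s : 'S_n, p = existT _ n (sact x s, s^-1 i).

Definition lact c g (v : letter c) : letter c :=
  fun p => v (existT _ (tag p) (gact g^-1 (tagged p).1, (tagged p).2)).

Lemma input_sact c n (x : S c n) s i : input (sact x s) i = input x (s i).
Proof.
apply/funext => p; apply/propext; split=> -[t ->].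
  by exists (t * s); rewrite sactM invMg permM permK.
by exists (t * s^-1); rewrite -sactM mulgKV invMg invgK permM.
Qed.

Lemma pair_existT_inj c n (x y : S c n) (i j : 'I_n) :
  existT (fun n => (S c n * 'I_n)%type) n (x, i) = existT _ n (y, j) -> x = y /\ i = j.
Proof.
pose Q (p q : {n & (S c n * 'I_n)%type}) := forall e : tag q = tag p,
  (tagged p).1 = arcast e (tagged q).1 /\ (tagged p).2 = cast_ord e (tagged q).2.
move=> E; have : Q (existT _ n (x, i)) (existT _ n (y, j)).
  rewrite E => e /=; rewrite (eq_irrelevance e erefl) /=; split=> //.
  by rewrite cast_ord_id.
by move=> /(_ erefl) [/= -> ->]; rewrite cast_ord_id.
Qed.

Lemma input_inj c n (x y : S c n) i j : input y j = input x i ->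
  exists s : 'S_n, y = sact x s /\ s j = i.
Proof.
move=> E; have : input x i (existT _ n (y, j)).
  by rewrite -E; exists 1; rewrite sact1 invg1 perm1.
case=> s /pair_existT_inj[-> ->]; exists s.
by rewrite permKV.
Qed.

Lemma lact_input c g n (x : S c n) i : lact g (input x i) = input (gact g x) i.
Proof.
apply/funext => -[m [y j]]; apply/propext; split=> -[s] /= E; exists s; last first.
  have [nm] : tag (existT (fun n => (S c n * 'I_n)%type) m (y, j)) = n by rewrite E.
  simpl in nm; case: n / nm x i s E => x i s /pair_existT_inj[-> ->].
  by rewrite -gsactC -gactM mulVg gact1.
have [nm] : tag (existT (fun n => (S c n * 'I_n)%type) m (gact g^-1 y, j)) = n by rewrite E.
simpl in nm; case: n / nm x i s E => x i s /pair_existT_inj[E ->].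
by rewrite -gsactC -E -gactM mulgV gact1.
Qed.

Lemma lact1 c (v : letter c) : lact 1 v = v.
Proof. by apply/funext => -[n [x i]]; rewrite /lact /= invg1 gact1. Qed.

Lemma lactM c g h (v : letter c) : lact (g * h) v = lact g (lact h v).
Proof. by apply/funext => -[n [x i]]; rewrite /lact /= invMg gactM. Qed.

(** A product of two free monoids: letters of different colours commute, while each colour keeps its
    order. *)
Definition word := forall c, seq (letter c).
Definition wone : word := fun=> [::].
Definition wmul (v w : word) : word := fun c => v c ++ w c.
Definition wact g (w : word) : word := fun c => map (lact g) (w c).
Definition wletter c (v : letter c) : word := fun d =>
  match c =P d with
  | ReflectT e => [:: eq_rect c letter v d e]
  | ReflectF _ => [::]
  end.

Lemma wordP (v w : word) : (forall c, v c = w c) -> v = w.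
Proof. exact: functional_extensionality_dep. Qed.

Lemma wletterE c (v : letter c) : wletter v c = [:: v].
Proof. by rewrite /wletter; case: eqP => // e; rewrite (eq_irrelevance e erefl). Qed.

Lemma wletter_neq c d (v : letter c) : c != d -> wletter v d = [::].
Proof. by rewrite /wletter; case: eqP. Qed.

Lemma wmul1w w : wmul wone w = w. Proof. exact/wordP. Qed.
Lemma wmulw1 w : wmul w wone = w. Proof. by apply: wordP => c; apply: cats0. Qed.
Lemma wmulA u v w : wmul u (wmul v w) = wmul (wmul u v) w.
Proof. by apply: wordP => c; apply: catA. Qed.

Lemma wmulI u v w : wmul u v = wmul u w -> v = w.
Proof.
move=> E; apply: wordP => c; have := congr1 (drop (size (u c)) \o @^~ c) E.
by rewrite /= /wmul !drop_size_cat.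
Qed.

Lemma wmul_letterI c (u v : letter c) w w' :
  wmul (wletter u) w = wmul (wletter v) w' -> u = v.
Proof. by move/(congr1 (@^~ c)); rewrite /wmul !wletterE => -[]. Qed.

Lemma wact1 w : wact 1 w = w.
Proof. by apply: wordP => c; rewrite /wact (eq_map (@lact1 c)) map_id. Qed.
Lemma wactM g h w : wact (g * h) w = wact g (wact h w).
Proof. by apply: wordP => c; rewrite /wact -map_comp; apply/eq_map/lactM. Qed.
Lemma wact_one g : wact g wone = wone. Proof. exact: wordP. Qed.
Lemma wact_mul g v w : wact g (wmul v w) = wmul (wact g v) (wact g w).
Proof. by apply: wordP => c; apply: map_cat. Qed.

Lemma wact_letter g c (v : letter c) : wact g (wletter v) = wletter (lact g v).
Proof.
apply: wordP => d; rewrite /wact /wletter; case: eqP => // e.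
by case: d / e.
Qed.

Lemma wact_inj g : injective (wact g).
Proof. by move=> v w /(congr1 (wact g^-1)); rewrite -!wactM mulVg !wact1. Qed.

Lemma word_arcast m n (e : m = n) (a : 'I_m -> word) i :
  arcast (S := fun n => 'I_n -> word) e a i = a (cast_ord (esym e) i).
Proof. by case: n / e i => i /=; rewrite cast_ord_id. Qed.

Program Definition word_sym : symseq G := {|
  sym_car n := 'I_n -> word;
  gact n g a := fun i => wact g (a i);
  sact n a s := fun i => a (s i) |}.
Next Obligation. by move=> n a; apply/funext => i; rewrite wact1. Qed.
Next Obligation. by move=> n g h a; apply/funext => i; rewrite wactM. Qed.
Next Obligation. by move=> n a; apply/funext => i; rewrite perm1. Qed.
Next Obligation. by move=> n a s t; apply/funext => i; rewrite permM. Qed.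
Next Obligation. by []. Qed.

(* a(b_1, ..., b_n) sends its input (i, j) to the path from the root to (i, j). *)
Program Definition word_operad : operad G := {|
  op_sym := word_sym;
  opid := fun=> wone;
  gam n k a b := fun c => wmul (a (rk1 c)) (b (rk1 c) (rk2 c)) |}.
Next Obligation. by move=> g; apply/funext => i; rewrite /= wact_one. Qed.
Next Obligation. by move=> n k g x y; apply/funext => i; rewrite /= wact_mul. Qed.
Next Obligation.
move=> m y; apply/funext => i; rewrite word_arcast wmul1w.
by rewrite -sum_one_cast cast_ordKV.
Qed.
Next Obligation.
move=> n x; apply/funext => i; rewrite word_arcast wmulw1.
by rewrite -sum_ones_cast cast_ordKV.
Qed.
Next Obligation.
move=> n k l x y z; apply/funext => c; rewrite word_arcast.
rewrite -[c in RHS](cast_ordKV (sum_sum l)); move: (cast_ord (esym _) c) => {}c.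
rewrite sum_sum_cast.
rewrite (rkK (fun i c => wmul (x i) (wmul (y i (rk1 c)) (z i (rk1 c) (rk2 c))))).
rewrite (rkK (fun j c => wmul (x _) (wmul (y _ j) (z _ j c)))).
by rewrite wmulA.
Qed.
Next Obligation.
move=> n k x s y; apply/funext => c; rewrite /= word_arcast permE /block_fun cast_ordK.
by rewrite (rkK (fun i c => wmul (x i) (y i c))).
Qed.
Next Obligation.
move=> n k x y t; apply/funext => c; rewrite /= permE /dsum_fun.
by rewrite (rkK (fun i c => wmul (x i) (y i c))).
Qed.

Definition word_gen c n (x : S c n) : word_operad n := fun i => wletter (input x i).

Lemma word_gen_symhom c : @is_symhom G (S c) word_operad (@word_gen c).
Proof.
split=> [n g x|n x s]; apply/funext => i; rewrite /= /word_gen.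
  by rewrite wact_letter lact_input.
by rewrite input_sact.
Qed.
End Words.

(** * Paths in trees *)

Section GoodWords.
Variables (G : finGroupType) (S : bool -> symseq G).
Local Notation word := (word S).
Local Notation W := (word_operad S).

(** Two distinct paths have no common extension. This is stronger than injectivity and, unlike it,
    is preserved by grafting. *)
Definition incomparable n (a : 'I_n -> word) : Prop :=
  forall i j v w, wmul (a i) v = wmul (a j) w -> i = j.

Definition wnode c n (x : S c n) (B : 'I_n -> word -> Prop) : word -> Prop :=
  fun w => exists i v, B i v /\ w = wmul (wletter (input x i)) v.

(* The sets of the paths from the root to the inputs, in the trees with
   vertices labelled by S. *)
Inductive path_set : (word -> Prop) -> Prop :=
| path_unit : path_set (eq (wone S))
| path_node c n (x : S c n) B : (forall i, path_set (B i)) -> path_set (wnode x B).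

(** This is grafting: at the end of each path a of a tree one attaches a tree with path set B a.
    Below an input of the root, B is used with the first edge as a prefix. *)
Lemma path_set_mul A (B : word -> word -> Prop) : path_set A ->
  (forall a, A a -> path_set (B a)) ->
  path_set (fun w => exists a b, [/\ A a, B a b & w = wmul a b]).
Proof.
move=> pA; elim: pA B => [|c n x A' _ IH] B pB.
  suff -> : (fun w => exists a b, [/\ wone S = a, B a b & w = wmul a b]) = B (wone S).
    exact: pB.
  apply/funext => w; apply/propext; split=> [[a [b [<- Bb ->]]]|Bw].
    by rewrite wmul1w.
  by exists (wone S), w; rewrite wmul1w.
pose B' i w := exists a b, [/\ A' i a, B (wmul (wletter (input x i)) a) b & w = wmul a b].
suff -> : (fun w => exists a b, [/\ wnode x A' a, B a b & w = wmul a b]) = wnode x B'.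
  by apply: path_node => i; apply: IH => a Aa; apply: pB; exists i, a.
apply/funext => w; apply/propext; split.
  case=> _ [b [[i [v [Av ->]]] Bb ->]]; exists i, (wmul v b); split; last by rewrite wmulA.
  by exists v, b.
case=> i [_ [[a [b [Aa Bb ->]]] ->]]; exists (wmul (wletter (input x i)) a), b.
by split=> //; [exists i, a|rewrite wmulA].
Qed.

Lemma path_set_act g A : path_set A -> path_set (fun w => A (wact g w)).
Proof.
elim=> [|c n x B _ IH].
  suff -> : (fun w => wone S = wact g w) = eq (wone S) by apply: path_unit.
  apply/funext => w; apply/propext; split=> [E|<-]; last by rewrite wact_one.
  by apply: (@wact_inj _ _ g); rewrite wact_one.
suff -> : (fun w => wnode x B (wact g w)) =
    wnode (gact g^-1 x) (fun i w => B i (wact g w)) by apply: path_node.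
apply/funext => w; apply/propext; split=> -[i [v [Bv E]]].
  exists i, (wact g^-1 v); rewrite -wactM mulgV wact1; split=> //.
  by rewrite -lact_input -wact_letter -wact_mul -E -wactM mulVg wact1.
exists i, (wact g v); split=> //.
by rewrite E wact_mul wact_letter lact_input -gactM mulgV gact1.
Qed.

Definition tree_like n (a : W n) : Prop :=
  incomparable a /\ path_set (fun w => exists i, w = a i).

Lemma tree_like_closed : op_closed (C := W) tree_like.
Proof.
split=> [n g a [inca pa]|n a s [inca pa]||n k a b [inca pa] pb].
- split=> [i j v w /= E|].
    apply: (inca i j (wact g^-1 v) (wact g^-1 w)); apply: (@wact_inj _ _ g).
    by rewrite !wact_mul -!wactM mulgV !wact1.
  rewrite (_ : (fun w => _) = fun w => exists i, wact g^-1 w = a i).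
    exact: (path_set_act g^-1 pa).
  apply/funext => w; apply/propext; split=> -[i E]; exists i.
    by rewrite E /= -wactM mulVg wact1.
  by rewrite /= -E -wactM mulgV wact1.
- split=> [i j v w /inca|]; first exact: perm_inj.
  rewrite (_ : (fun w => _) = fun w => exists i, w = a i) //.
  apply/funext => w; apply/propext; split=> -[i ->]; first by exists (s i).
  by exists (s^-1 i); rewrite /= permKV.
- split=> [i j _ _ _|]; first by rewrite [i]ord1 [j]ord1.
  rewrite (_ : (fun w => _) = eq (wone S)); first exact: path_unit.
  by apply/funext => w; apply/propext; split=> [[_ ->]//|<-]; exists ord0.
split=> [c d v w /=|].
  (* Incomparability of [a] identifies the first indices; cancelling the common prefix leaves the
     case of a single [b i]. *)
  rewrite -!wmulA => E; have rcd := inca _ _ _ _ E.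
  rewrite -(tagnat.sig2K c) -(tagnat.sig2K d); move: (rk2 c) (rk2 d) E; rewrite rcd.
  by move=> c2 d2 /wmulI/(pb (rk1 d)).1 ->.
have injai i j : a i = a j -> i = j.
  by move=> E; apply: (inca _ _ (wone S) (wone S)); rewrite E.
rewrite (_ : (fun w => _) = fun w => exists u v,
    [/\ exists i, u = a i, exists i, u = a i /\ exists j, v = b i j & w = wmul u v]).
  apply: (path_set_mul pa
    (B := fun u v => exists i, u = a i /\ exists j, v = b i j)) => _ [i ->].
  rewrite (_ : (fun w => _) = fun v => exists j, v = b i j); first exact: (pb i).2.
  apply/funext => v; apply/propext; split=> [[i' [/injai <-//]]|vj].
  by exists i.
apply/funext => w; apply/propext; split=> [[c ->]|[_ [_ [_ [i [-> [j ->]]] ->]]]].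
  by exists (a (rk1 c)), (b (rk1 c) (rk2 c)); split=> //;
     exists (rk1 c) => //; split=> //; exists (rk2 c).
by exists (rk i j); rewrite /= (rkK (fun i j => wmul (a i) (b i j))).
Qed.

Variables (Op : bool -> operad G) (theta : forall c, symhom (S c) (Op c)).
Hypothesis freeOp : forall c, sigma_free (Op c).

(** Freeness is reflected by the equivariant map [theta] into a Sigma-free operad. *)
Lemma gen_sact_inj c n (x : S c n) s t : sact x s = sact x t -> s = t.
Proof.
have [_ ths] := symhomP (theta c).
by move/(congr1 (theta c n)); rewrite !ths => /(sact_inj (@freeOp c)).
Qed.

Lemma input_injr c n (x : S c n) : injective (input x).
Proof.
move=> i j /input_inj[s [E <-]].
have -> : s = 1 by apply: (@gen_sact_inj c n x); rewrite sact1 -E.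
by rewrite perm1.
Qed.

Lemma tree_like_gen c n (x : S c n) : tree_like (word_gen x).
Proof.
split=> [i j v w /wmul_letterI/input_injr //|].
rewrite (_ : (fun w => _) = wnode x (fun=> eq (wone S))).
  by apply: path_node => i; apply: path_unit.
apply/funext => w; apply/propext; split=> [[i ->]|[i [_ [<- ->]]]]; exists i.
  by exists (wone S); rewrite wmulw1.
by rewrite wmulw1.
Qed.

(** The first edge of a path is its first letter of the colour of the root. Comparing the first
    letters of a path and of its image under h gives h x = x s, so K acts on the inputs of x; the
    fiber over an input is the path set of the subtree there. *)
Lemma path_set_indexing (L : hclass G) : is_indexing_system L ->
  (forall c, hclass_sub (admissible (Op c)) L) ->
  forall A, path_set A -> forall (K : {group G}) (T : finHset K) (f : T -> word),
    injective f -> {in K, forall h t, f (hact h t) = wact h (f t)} ->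
    (forall w, A w <-> exists t, w = f t) -> L K T.
Proof.
move=> sL LOp A; elim=> [|c n x B _ IH] K T f injf fK Af.
  apply: (idx_trivial sL) => h Hh t; apply: injf.
  have f1 s : f s = wone S by apply/esym/Af; exists s.
  by rewrite !f1.
(* Without a path there is nothing to show that K preserves the root up to renumbering, but the
   empty set is trivial. *)
case: (pselect (exists t : T, True)) => [[t0 _]|noT]; last first.
  by apply: (idx_trivial sL) => h Hh t; case: noT; exists t.
have fE t : exists i v, B i v /\ f t = wmul (wletter (input x i)) v by apply/Af; exists t.
have uK h : h \in K -> exists s : 'S_n, gact h x = sact x s.
  move=> Hh; have [i [v [_ E]]] := fE t0; have [j [w [_]]] := fE (hact h t0).
  rewrite fK // E wact_mul wact_letter lact_input => /wmul_letterI/input_inj[s [-> _]].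
  by exists s.
have [thg ths] := symhomP (theta c).
have xK h : exists s : 'S_n, h \in K -> gact h (theta c n x) = sact (theta c n x) s.
  case Hh: (h \in K); last by exists 1.
  by have [s xs] := uK h Hh; exists s; rewrite -thg xs ths.
pose N := sym_hset (@freeOp c) xK.
have inputK h i v : h \in K -> wact h (wmul (wletter (input x i)) v)
    = wmul (wletter (input x (hact (f := N) h i))) (wact h v).
  move=> Hh; have [s xs] := uK h Hh.
  rewrite wact_mul wact_letter lact_input xs input_sact.
  have Ex : gact h (theta c n x) = sact (theta c n x) s by rewrite -thg xs ths.
  by rewrite /= (sym_hactE (@freeOp c) xK Hh Ex).
pose p (t : T) : N := sval (cid (fE t)).
have pE t : exists v, B (p t) v /\ f t = wmul (wletter (input x (p t))) v.
  by rewrite /p; case: cid.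
(* The rest of the path after its first edge. *)
pose r t := sval (cid (pE t)).
have rB t : B (p t) (r t) by rewrite /r; case: cid => v [].
have rE t : f t = wmul (wletter (input x (p t))) (r t) by rewrite /r; case: cid => v [].
have p_uniq t i v : f t = wmul (wletter (input x i)) v -> p t = i.
  by rewrite rE => /wmul_letterI/input_injr.
have ph : is_hmap p.
  by move=> h Hh t; apply: (p_uniq _ _ (wact h (r t))); rewrite fK // rE inputK.
apply: (@idx_fibers _ _ L T N p ph sL); first exact/LOp/admissible_sym.
move=> i; apply: (IH i _ (fib_hset ph i) (fun t => r (val t))) => [s t E|h Hh t|w].
- by apply/val_inj/injf; rewrite !rE (eqP (valP s)) (eqP (valP t)) E.
- rewrite val_fib_hact //; have [HhK hi] := hstabP _ _ Hh.
  move: (val t) (eqP (valP t)) => {}t pt.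
  have pht : p (hact h t) = i by rewrite ph // pt.
  apply: (@wmulI _ _ (wletter (input x i))).
  by rewrite -{1}pht -rE fK // rE pt inputK // hi.
split=> [Bw|[t ->]]; last by rewrite -{1}(eqP (valP t)).
have [t wt] : exists t, wmul (wletter (input x i)) w = f t by apply/Af; exists i, w.
have pt : p t == i by apply/eqP/(p_uniq t i w).
exists (exist _ t pt) => /=; apply: (@wmulI _ _ (wletter (input x i))).
by rewrite wt rE (eqP pt).
Qed.

End GoodWords.

(** * Tensor products *)

Section Tensor.
Variables (G : finGroupType) (O P C T : operad G).
Variables (i : ophom O C) (j : ophom P C) (q : ophom C T).
Hypothesis tens : is_tensor i j q.
Local Notation Op := (opfam O P).
Variables (S : bool -> symseq G) (F : bool -> operad G).
Variables (eta : forall c, symhom (S c) (F c)).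
Hypothesis free : forall c, is_free_on (eta c).
Variables (sec : forall c, ophom (Op c) (F c)) (ret : forall c, ophom (F c) (Op c)).
Hypotheses (freeO : sigma_free O) (freeP : sigma_free P).
Local Notation W := (word_operad S).

(** This plays the part of [theta]: it compares the generators with operations of O and P. *)
Definition gen_op c n (x : S c n) : Op c n := ret c n (eta c n x).

Lemma gen_op_symhom c : is_symhom (@gen_op c).
Proof.
have [[[rg rs] _ _] [eg es]] := (ophomP (ret c), symhomP (eta c)).
by split=> *; rewrite /gen_op ?eg ?es ?rg ?rs.
Qed.

Lemma path_hom c : exists phi : ophom (F c) W,
  (forall n x, tree_like (phi n x)) /\
  (forall n x b d, c != d -> phi n x b d = [::]).
Proof.
have [phi [phi_gen _]] := free (Symhom (@word_gen_symhom G S c)).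
have [[pg ps] p1 pm] := ophomP phi; exists phi; split.
  have [tg ts t1 tm] := tree_like_closed S.
  apply: (free_ind (Phi := fun n x => tree_like (phi n x)) (@free c)) => [|n x].
    split=> [n g x|n x s||n k x y tx ty]; rewrite ?pg ?ps ?p1 ?pm; auto.
  rewrite phi_gen.
  exact: (tree_like_gen (fun c => Symhom (@gen_op_symhom c)) (free_opfam freeO freeP)).
move=> n x b d cd; move: n x b.
apply: (free_ind (Phi := fun n x => forall b, phi n x b d = [::]) (@free c)) => [|n x b].
  split=> [n g x IH b|n x s IH b|b|n k x y IHx IHy b].
  - by rewrite pg /= /wact IH.
  - by rewrite ps /= IH.
  - by rewrite p1.
  by rewrite pm /= /wmul IHx IHy.
by rewrite phi_gen /= /word_gen wletter_neq.
Qed.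

(** Words of elements of O and of P have letters of different colours, hence commute. So the kernel
    of [phi] is a congruence containing the interchange relations, and [phi] is constant on the
    fibers of [q]. *)
Lemma tensor_paths : exists phi : ophom C W,
  (forall n z, tree_like (phi n z)) /\ (forall n y z, q n y = q n z -> phi n y = phi n z).
Proof.
have [cop [_ qker]] := tens.
have [f [tree_f nil_f]] := path_hom true; have [g [tree_g nil_g]] := path_hom false.
have [phi [[phi_i phi_j] _]] := cop _ (comp_ophom f (sec true)) (comp_ophom g (sec false)).
have [[pg ps] p1 pm] := ophomP phi; exists phi; split.
  have [tg ts t1 tm] := tree_like_closed S.
  apply: (coproduct_ind (Phi := fun n z => tree_like (phi n z)) cop) => [|n x|n x].
  - by split=> [n h x|n x s||n k x y tx ty]; rewrite ?pg ?ps ?p1 ?pm; auto.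
  - by rewrite phi_i; apply: (tree_f n (sec true n x)).
  by rewrite phi_j; apply: (tree_g n (sec false n x)).
move=> n y z /qker yz; apply: (yz (fun n y z => phi n y = phi n z)).
  split=> {n y z yz} [n x|n x y|n x y z|n h x y|n x y s|n k x x' y y' xx' yy'].
  - by [].
  - by move=> ->.
  - by move=> -> ->.
  - by rewrite !pg => ->.
  - by rewrite !ps => ->.
  by rewrite !pm xx'; congr gam; apply: functional_extensionality_dep.
move=> _ _ _ [m n' h k]; rewrite pm ps (arcast_map phi) pm phi_i phi_j.
apply/funext => a; rewrite /= word_arcast permE /swap_fun cast_ordK.
rewrite (@rkK n' (fun=> m) _
  (fun b c => wmul (g n' (sec false n' k) b) (f m (sec true m h) c))).
(* In each colour one of the two factors is empty. *)
apply: wordP => -[]; rewrite /wmul.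
  by rewrite (nil_g _ _ _ true) // cats0.
by rewrite (nil_f _ _ _ false) // cats0.
Qed.

(** A permutation fixing an element of the tensor product preserves each path of a lift of it to C,
    and distinct inputs have distinct paths. *)
Lemma tensor_sigma_free : sigma_free T.
Proof.
have [_ [qsurj _]] := tens; have [phi [tree_phi phi_q]] := tensor_paths.
have [[_ qs] _ _] := ophomP q; have [[_ ps] _ _] := ophomP phi.
move=> n z s; have [x <-] := qsurj n z; rewrite -qs => /phi_q; rewrite ps => E.
apply/permP => a; rewrite perm1; have [inc _] := tree_phi n x.
by apply: (inc _ _ (wone S) (wone S)); move/(congr1 (@^~ a)): E => /= ->.
Qed.

Lemma tensor_admissible (L : hclass G) : is_indexing_system L ->
  hclass_sub (admissible O) L -> hclass_sub (admissible P) L ->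
  hclass_sub (admissible T) L.
Proof.
have [_ [qsurj _]] := tens; have [phi [tree_phi phi_q]] := tensor_paths.
have [[qg qs] _ _] := ophomP q; have [[pg ps] _ _] := ophomP phi.
move=> sL LO LP H U /admissibleP[[n z e] [/sum_eq_bijP bije fixz]].
have [z' zE] := qsurj n z; simpl in *; have [inc pset] := tree_phi n z'.
have [e' eK e'K] := bije.
apply: (path_set_indexing (fun c => Symhom (@gen_op_symhom c)) (free_opfam freeO freeP)
  sL _ pset (f := fun u => phi n z' (e' u))).
- by case.
- move=> u v E; apply: (can_inj e'K); apply: (inc _ _ (wone S) (wone S)).
  by rewrite E.
- move=> h Hh u; have /lequivP[s [zs es]] := fixz h Hh.
  (* The lift z' need not satisfy h z' = z' s in C, but both sides have the same image in T, hence
     the same paths. *)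
  have : phi n (gact h z') = phi n (sact z' s) by apply: phi_q; rewrite qg qs zE.
  rewrite pg ps => /(congr1 (@^~ (e' u))) /= ->.
  by rewrite -{1}(e'K u) es eK.
move=> w; split=> [[a ->]|[u ->]]; last by exists (e' u).
by exists (e a); rewrite eK.
Qed.

End Tensor.

(** * From Sigma-freeness and upper bounds to the theorem *)

Lemma N_operad_along (G : finGroupType) (O T : operad G) (f : ophom O T) :
  is_N_operad O -> sigma_free T -> is_N_operad T.
Proof.
have [[fg _] _ _] := ophomP f.
move=> NO freeT n; split; first exact: freeT.
by have [_ [x fixx]] := NO n; exists (f n x) => g; rewrite -fg fixx.
Qed.

(** The admissible sets of T form an indexing system, which contains those of O and P by
    functoriality and so contains the join; [least] is the other inclusion. *)
Lemma N_operad_join (G : finGroupType) (O P T : operad G) (f : ophom O T) (g : ophom P T) :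
  is_N_operad T ->
  (forall L, is_indexing_system L -> hclass_sub (admissible O) L ->
     hclass_sub (admissible P) L -> hclass_sub (admissible T) L) ->
  hclass_eq (admissible T) (idx_join (admissible O) (admissible P)).
Proof.
move=> NT least H U; split=> [TU L sL LO LP|]; first exact: (least L sL LO LP).
apply; first by apply: admissible_indexing_system => n; case: (NT n).
  by move=> K V; apply: ophom_admissible f _ _.
by move=> K V; apply: ophom_admissible g _ _.
Qed.

Theorem theoremA (G : finGroupType) (O P : operad G)
    (NO : is_N_operad O) (NP : is_N_operad P) :
  [/\ forall (X : operad G) (p : ophom X O) (q : ophom X P),
        is_product p q ->
        is_N_operad X /\
        hclass_eq (admissible X) (idx_meet (admissible O) (admissible P)),
      forall (C : operad G) (i : ophom O C) (j : ophom P C),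
        is_coproduct i j ->
        is_N_operad C /\
        hclass_eq (admissible C) (idx_join (admissible O) (admissible P))
    & is_retract_of_free O -> is_retract_of_free P ->
      forall (C T : operad G) (i : ophom O C) (j : ophom P C) (q : ophom C T),
        is_tensor i j q ->
        is_N_operad T /\
        hclass_eq (admissible T) (idx_join (admissible O) (admissible P))].
Proof.
have freeO : sigma_free O by move=> n; case: (NO n).
have freeP : sigma_free P by move=> n; case: (NP n).
split=> [X p q prod|C i j cop|].
(* The comparison map [h] turns pairs of fixed operations into fixed operations of X, and [p]
   reflects freeness. *)
- have [h _] := prod (prod_operad O P) (Ophom (@fst_ophom _ O P)) (Ophom (@snd_ophom _ O P)).
  have [[pg ps] _ _] := ophomP p; have [[hg hs] _ _] := ophomP h.
  split=> [n|H T].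
    split=> [x s xs|]; first by apply: (freeO n (p n x)); rewrite -ps xs.
    have [[_ [x fx]] [_ [y fy]]] := (NO n, NP n).
    by exists (h n (x, y)) => g; rewrite -hg /= fx fy.
  split=> [XT|[[x fixx] [y fixy]]].
    by split; [apply: (ophom_admissible p)|apply: (ophom_admissible q)].
  apply: (ophom_admissible h); exists (x, y) => k kT.
  by have := fixx k kT; have := fixy k kT; rewrite /gsact /= => -> ->.
- have NC : is_N_operad C.
    by apply: (N_operad_along i NO); apply: coproduct_sigma_free cop _ _.
  split=> //; apply: (N_operad_join i j NC) => L.
  exact: coproduct_admissible cop freeO freeP L.
move=> [F0 [s0 [r0 [[S0 [eta0 free0]] rs0]]]] [F1 [s1 [r1 [[S1 [eta1 free1]] rs1]]]].
move=> C T i j q tens.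
pose S c := if c then S0 else S1; pose F c := if c then F0 else F1.
pose eta c : symhom (S c) (F c) :=
  if c return symhom (S c) (F c) then eta0 else eta1.
pose sec c : ophom (opfam O P c) (F c) :=
  if c return ophom (opfam O P c) (F c) then s0 else s1.
pose ret c : ophom (F c) (opfam O P c) :=
  if c return ophom (F c) (opfam O P c) then r0 else r1.
have free c : is_free_on (eta c) by case: c.
have NT : is_N_operad T.
  apply: (N_operad_along (comp_ophom q i) NO).
  exact: (tensor_sigma_free tens free sec ret freeO freeP).
split=> //; apply: (N_operad_join (comp_ophom q i) (comp_ophom q j) NT) => L.
exact: (tensor_admissible tens free sec ret freeO freeP).
Qed.
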